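(* Let $\alpha>2$, $\beta>0$, $N_o>0$ and $\gamma\ge 0$ be fixed, and consider the many-to-many communication task described in the context, with propagation model $\eta(d)=\frac{1}{(1+d)^\alpha}$ and the SINR$_\beta$ success criterion. Then there exist constants $c,\overline{c}>0$ depending only on $\alpha,\beta$ such that for every $n$ there is a power $P_n>0$ and for every source-destination set $\mathcal{P}_n$ there is a system $\mathcal{S}_n(\mathcal{P}_n)$ (all transmissions using power $P_n$), with throughput $\lambda_n(\mathcal{P}_n)$, such that for any packet size $W>0$ (bits per slot), as $n\to\infty$, $$\Pr\big(\mathcal{S}_n(\mathcal{P}_n)\text{ is SINR}_\beta\text{-successful at power }P_n\big)\to 1,$$ and - if $\gamma<\tfrac12$: $\Pr\Big(\lambda_n(\mathcal{P}_n)\ge \frac{W}{c\, n^{1-\gamma}}\Big)\to 1$; - if $\gamma\ge\tfrac12$: $\Pr\Big(\lambda_n(\mathcal{P}_n)\ge \frac{W}{\overline{c}\sqrt{n\ln n}}\Big)\to 1$, where probabilities are over the random source-destination set $\mathcal{P}_n$. Moreover, when $\gamma<\tfrac12$, $P_n$ depends on $\alpha,\beta,N_o$ but not on $n$, $\mathcal{P}_n$ or $\gamma$; when $\gamma\ge\tfrac12$, $P_n$ depends on $\alpha,\beta,N_o$, increases with $n$ and $\gamma$, and does not depend on $\mathcal{P}_n$.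
   Context: Network model: $A_n\subset\mathbb{R}^2$ is a disk of radius $n^\gamma$. Nodes $s_1,\dots,s_n$ (identified with their locations) are drawn i.i.d. uniformly on $A_n$; for each $i$, a destination $d_i$ is chosen uniformly from $\{s_j: j\ne i\}$, independently of everything else (two sources may share a destination). The source-destination set is $\mathcal{P}_n=\{(s_1,d_1),\dots,(s_n,d_n)\}$. Time is slotted; every transmitter transmits with the same power $P$ and sends at most one packet of $W$ bits per slot. A route for $(s_i,d_i)$ is a finite sequence of hops $h_{i,j}=(t_{i,j},r_{i,j})$, $j=1,\dots,J_i$, of nodes, with $t_{i,1}=s_i$, $r_{i,j}=t_{i,j+1}$, $r_{i,J_i}=d_i$, and no node repeated. A schedule assigns to each hop a positive integer slot $\sigma_{i,j}$. A system is a set of $n$ scheduled routes, one per pair, that is compatible: no two hops (of the same or different routes) require the same node to transmit in the same slot. Its period is $p=\max_{i,j}\sigma_{i,j}$ and it operates periodically with this period; its throughput is $\lambda=W/p$ bits per slot. For slot $j\in\{1,\dots,p\}$, the hop set $\mathcal{H}_j$ is the set of hops scheduled in slot $j$ and $T_j$ the set of their transmitters. A hop set is successful (under a given criterion) if every hop $(t,r)\in\mathcal{H}_j$ satisfies the criterion with interfering set $T=T_j\setminus\{t\}$; a system is successful if all its hop sets are. SINR$_\beta$ criterion at power $P$ (with noise power $N_o$ and propagation model $\eta$): a transmission from $t$ to $r$ in presence of simultaneous transmitters at the points of a finite set $T$ succeeds iff $$\mathrm{SINR}=\frac{P\eta(\|t-r\|)}{N_o+\sum_{t'\in T}P\eta(\|t'-r\|)}\ge\beta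 .$$ *)

(* Defs.v *)
From HB Require Import structures.
From mathcomp Require Import all_boot all_order all_algebra.
From mathcomp Require Import all_classical all_reals all_analysis.
Set Implicit Arguments. Unset Strict Implicit. Unset Printing Implicit Defensive.
Import Order.TTheory GRing.Theory Num.Theory.
Import numFieldNormedType.Exports.
Local Open Scope classical_set_scope.
Local Open Scope ring_scope.

Section Model.
Variable R : realType.

Definition dist2 (x y : R * R) : R :=
  Num.sqrt ((x.1 - y.1) ^+ 2 + (x.2 - y.2) ^+ 2).

Definition diskA (gamma : R) (n : nat) : set (R * R) :=
  [set x | Num.sqrt (x.1 ^+ 2 + x.2 ^+ 2) <= (n%:R) `^ gamma].

Definition eta (alpha d : R) : R := ((1 + d) `^ alpha)^-1.

(* A scheduled route for one source-destination pair, on node indices 'I_n: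
   rnodes = [:: t_1 = s; t_2; ...; t_J; r_J = d]  (J+1 nodes),
   rslots = [:: sigma_1; ...; sigma_J] (slot of hop j). *)
Record sroute (n : nat) := SRoute { rnodes : seq 'I_n ; rslots : seq nat }.

Definition system (n : nat) := 'I_n -> sroute n.

Definition nhops n (r : sroute n) : nat := size (rslots r).
Definition htx n (src : 'I_n) (r : sroute n) (j : nat) : 'I_n := nth src (rnodes r) j.
Definition hrx n (src : 'I_n) (r : sroute n) (j : nat) : 'I_n := nth src (rnodes r) j.+1.
Definition hslot n (r : sroute n) (j : nat) : nat := nth 0%N (rslots r) j.

Definition is_sroute n (src dst : 'I_n) (r : sroute n) : Prop :=
  [/\ size (rnodes r) = (nhops r).+1, (0 < nhops r)%N,
      head src (rnodes r) = src /\ last src (rnodes r) = dst,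
      uniq (rnodes r) & all (fun s => 0 < s)%N (rslots r)].

Definition compatible n (S : system n) : Prop :=
  forall (i1 i2 : 'I_n) (j1 j2 : nat),
    (j1 < nhops (S i1))%N -> (j2 < nhops (S i2))%N -> (i1, j1) <> (i2, j2) ->
    hslot (S i1) j1 = hslot (S i2) j2 -> htx i1 (S i1) j1 <> htx i2 (S i2) j2.

Definition is_system n (d : 'I_n -> 'I_n) (S : system n) : Prop :=
  (forall i, is_sroute i (d i) (S i)) /\ compatible S.

Definition period n (S : system n) : nat :=
  (\max_(i < n) \max_(s <- rslots (S i)) s)%N.

Definition throughput n (W : R) (S : system n) : R := W / (period S)%:R.

Definition transmits n (S : system n) (sig : nat) (k : 'I_n) : bool :=
  [exists i : 'I_n, has (fun j => (htx i (S i) j == k) && (hslot (S i) j == sig))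
                        (iota 0 (nhops (S i)))].

Definition sinr_ok n (alpha beta No P : R) (pos : 'I_n -> R * R)
    (S : system n) (sig : nat) (t r : 'I_n) : Prop :=
  P * eta alpha (dist2 (pos t) (pos r)) /
    (No + \sum_(k < n | (k != t) && transmits S sig k)
             P * eta alpha (dist2 (pos k) (pos r))) >= beta.

Definition successful n (alpha beta No P : R) (pos : 'I_n -> R * R)
    (S : system n) : Prop :=
  forall (i : 'I_n) (j : nat), (j < nhops (S i))%N ->
    sinr_ok alpha beta No P pos S (hslot (S i) j) (htx i (S i) j) (hrx i (S i) j).

Definition leb2 := ((@lebesgue_measure R) \x (@lebesgue_measure R))%E.

(* The random model for n nodes on a probability space (Omega, Pr):
   positions sv i and destinations dv i are random variables whose joint law is
   positions i.i.d. uniform on A_n, each d_i uniform on {j <> i}, independent. *)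
Definition random_model (gamma : R) (n : nat) (dO : measure_display)
    (Omega : measurableType dO) (Pr : probability Omega R)
    (sv : 'I_n -> Omega -> R * R) (dv : 'I_n -> Omega -> 'I_n) : Prop :=
  [/\ (forall i, measurable_fun setT (sv i)),
      (forall i j, measurable [set w | dv i w = j]) &
      (forall (B : 'I_n -> set (R * R)) (delta : 'I_n -> 'I_n),
         (forall i, measurable (B i)) -> (forall i, delta i != i) ->
         Pr [set w | forall i, B i (sv i w) /\ dv i w = delta i] =
         (\prod_(i < n) (fine (leb2 (B i `&` diskA gamma n))
                          / fine (leb2 (diskA gamma n)) / (n.-1)%:R))%:E)].

(* "Pr(event) -> 1" (in the inner-probability sense): there are measurable
   events E_n contained in the events ev_n whose probability tends to 1. *)
Definition whp (dO : nat -> measure_display) (Omega : forall n, measurableType (dO n))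
    (Pr : forall n, probability (Omega n) R) (ev : forall n, set (Omega n)) : Prop :=
  exists E : forall n, set (Omega n),
    [/\ (forall n, measurable (E n)), (forall n, E n `<=` ev n) &
        ((fun n => Pr n (E n)) @ \oo --> 1%E)].

End Model.

(* Main.v *)
Require Import Defs.
From HB Require Import structures.
From mathcomp Require Import all_boot all_order all_algebra.
From mathcomp Require Import all_classical all_reals all_analysis.
From mathcomp Require Import zify ring lra.
Import Order.TTheory GRing.Theory Num.Theory.
Import numFieldNormedType.Exports.
Local Open Scope ring_scope.

(** The disk, of radius n^g, is cut into square cells of side a = n^g / m.
    Traffic of a pair is carried along an L-shaped sequence of cells lying
    entirely inside the disk, one relay node per cell, with cells whose indices
    agree modulo a constant K active simultaneously.

    - Interference: with active cells K cells apart, it is at most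
      (K a / 2)^-alpha times the square of 2 sum_q max(1,q)^(-alpha/2), which
      converges since alpha > 2; so a large K, depending only on alpha and beta,
      makes it small against the useful signal (1 + 6 a)^-alpha whenever
      a >= 1/3, and the noise is beaten by a power of order (1 + 6 a)^alpha.
    - Load: a cell is crossed only by routes whose source or destination lies
      in its row or column, up to a bounded shift.  Exponential moments give
      O(n / m) such routes, first for the sources, then for the destinations
      conditionally on the positions; all cells inside the disk are occupied as
      soon as 12 m^2 ln n <= n.

    Hence the period is O(n / m); take m of order n^g when g < 1/2 and of order
    sqrt(n / ln n) otherwise. *)

(** * Cells and routes *)

Section Cells.
Local Open Scope nat_scope.

Definition dist_nat (a b : nat) : nat := (a - b) + (b - a).

(* Columns and rows are indexed by 0 .. 2m-1 in units of the cell side, the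
   centre of the disk being the corner m: index u covers [u - m, u + 1 - m], and
   [extent m u] is the largest absolute value on it. *)
Definition extent (m u : nat) : nat := if m <= u then u.+1 - m else m - u.

(* Shifting by two towards the centre (saturating next to it) turns a cell that
   merely meets the disk into one contained in it; a shift by one would fail for
   cells adjacent to an axis. *)
Definition home (m u : nat) : nat :=
  if m <= u then maxn (u - 2) m else minn u.+2 m.-1.

Definition inside (m : nat) (C : nat * nat) : bool :=
  extent m C.1 ^ 2 + extent m C.2 ^ 2 <= m ^ 2.

Lemma extent_gt0 m u : 0 < extent m u.
Proof. rewrite /extent; case: (leqP m u); lia. Qed.

Lemma home_dist m u : 0 < m -> dist_nat u (home m u) <= 2.
Proof. by rewrite /dist_nat /home => m0; case: (leqP m u) => h; lia. Qed.

Lemma extent_home m u : 0 < m -> extent m (home m u) = maxn (extent m u - 2) 1.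
Proof.
rewrite /extent /home => m0; case: (leqP m u) => h.
  rewrite ifT; lia.
rewrite ifF; lia.
Qed.

(** With a and b the two extents, if both are at least 2 then each drops by at least one. An extent
    equal to 1 cannot drop, and the other coordinate pays: 1 + (b-2)^2 <= (b-1)^2 for b >= 3. The
    remaining cells land next to the centre, where the sum is 2 <= m^2. *)
Lemma home_inside m u v : 1 < m ->
  (extent m u).-1 ^ 2 + (extent m v).-1 ^ 2 <= m ^ 2 ->
  inside m (home m u, home m v).
Proof.
move=> m1; rewrite /inside /= !extent_home ?(ltnW m1) //.
move: (extent m u) (extent m v) => a b.
have [a2|a2] := leqP a 3; have [b2|b2] := leqP b 3; rewrite -!mulnn => H; nia.
Qed.

(** [extent] decreases up to the centre and increases after it, so its maximum over a segment is
    reached at an end. *)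
Lemma extent_mid m a b x : minn a b <= x <= maxn a b ->
  extent m x <= maxn (extent m a) (extent m b).
Proof. rewrite /extent; case: (leqP m a); case: (leqP m b); case: (leqP m x); lia. Qed.

Lemma line_path (a b : nat) : exists p : seq nat,
  [/\ path (fun x y => dist_nat x y <= 1) a p, last a p = b &
      all (fun x => minn a b <= x <= maxn a b) p].
Proof.
move: {2}(dist_nat a b) (leqnn (dist_nat a b)) => k.
elim: k a => [|k IH] a; rewrite /dist_nat => H.
  exists [::]; split => //=; lia.
have [->|ab] := eqVneq a b; first by exists [::].
pose a' := if a < b then a.+1 else a.-1.
have [|p [pp lp ap]] := IH a'; first by rewrite /a' /dist_nat; case: (ltnP a b); lia.
exists (a' :: p); split => //=.
  by rewrite pp andbT /dist_nat /a'; case: (ltnP a b); lia.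
apply/andP; split; first by rewrite /a'; case: (ltnP a b); lia.
apply: sub_all ap => x; rewrite /a'; case: (ltnP a b); lia.
Qed.

Definition cell_near (d : nat) (C D : nat * nat) : bool :=
  (dist_nat C.1 D.1 <= d) && (dist_nat C.2 D.2 <= d).

Lemma corner_path (C D : nat * nat) : exists p : seq (nat * nat),
  [/\ path (cell_near 1) C p, last C p = D &
      all (fun X => (X.2 == C.2) && (minn C.1 D.1 <= X.1 <= maxn C.1 D.1) ||
                    (X.1 == D.1) && (minn C.2 D.2 <= X.2 <= maxn C.2 D.2)) p].
Proof.
have [p [pp lp ap]] := line_path C.1 D.1.
have [q [pq lq aq]] := line_path C.2 D.2.
have lC : last C [seq (x, C.2) | x <- p] = (D.1, C.2).
  by case: C lp {pp ap pq lq aq} => /= c1 c2 <-; rewrite (last_map (fun x => (x, c2))).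
exists ([seq (x, C.2) | x <- p] ++ [seq (D.1, y) | y <- q]); split.
- rewrite cat_path lC; apply/andP; split.
    case: C pp {lp ap pq lq aq lC} => /= c1 c2; rewrite -[(c1, c2)]/((fun x => (x, c2)) c1) path_map.
    by apply: sub_path => x y /=; rewrite /cell_near /= => ->; rewrite /dist_nat; lia.
  rewrite -[(D.1, C.2)]/((fun y => (D.1, y)) C.2) path_map; apply: sub_path pq => x y /=.
  by rewrite /cell_near /= => ->; rewrite /dist_nat; lia.
- by rewrite last_cat lC (last_map (fun y => (D.1, y))) lq; case: D {lp ap lq aq lC}.
- rewrite all_cat !all_map; apply/andP; split.
    by apply: sub_all ap => x /= ->; rewrite eqxx.
  by apply: sub_all aq => x /= ->; rewrite eqxx orbT.
Qed.

(** All that the load count needs to remember of an L-shaped path from C to D. *)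
Definition cross (C D X : nat * nat) : bool :=
  [|| X.1 == C.1, X.2 == C.2, X.1 == D.1 | X.2 == D.2].

(* One of the two corners of the rectangle spanned by C and D is no farther
   from the centre than the farther of C and D. *)
Lemma inside_path m (C D : nat * nat) : inside m C -> inside m D ->
  exists p : seq (nat * nat),
  [/\ path (cell_near 1) C p, last C p = D & all (fun X => inside m X && cross C D X) p].
Proof.
rewrite /inside => iC iD.
have [p [pp lp ap]] := corner_path C D.
have [iE|iE] := boolP (inside m (D.1, C.2)).
  exists p; split => //; apply: sub_all ap => X; rewrite /inside /cross /= in iE *.
  case/orP => /andP[/eqP e bX]; rewrite e eqxx ?orbT andbT.
    have := @extent_mid m _ _ _ bX; rewrite -!mulnn in iC iD iE *; nia.
  have := @extent_mid m _ _ _ bX; rewrite -!mulnn in iC iD iE *; nia.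
(* The two corners use the same four squared extents as C and D, of total at most 2 m^2, so they
   cannot both exceed m^2. *)
have iE' : inside m (C.1, D.2).
  by rewrite /inside /= in iE *; lia.
(* Exchanging the coordinates makes the path turn at the other corner. *)
have [q [pq lq aq]] := corner_path (C.2, C.1) (D.2, D.1).
pose sw (X : nat * nat) := (X.2, X.1).
exists (map sw q); split.
- have {1}-> : C = sw (C.2, C.1) by case: (C).
  rewrite path_map; apply: sub_path pq => x y; rewrite /cell_near /=; lia.
- have {1}-> : C = sw (C.2, C.1) by case: (C).
  by rewrite last_map lq; case: (D).
- rewrite all_map; apply: sub_all aq => X /=; rewrite /inside /cross /= in iE' *.
  case/orP => /andP[/eqP e bX]; rewrite e eqxx ?orbT andbT.
    have := @extent_mid m _ _ _ bX; rewrite -!mulnn in iC iD iE' *; nia.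
  have := @extent_mid m _ _ _ bX; rewrite -!mulnn in iC iD iE' *; nia.
Qed.

End Cells.

(** * Deterministic routing and scheduling from occupied cells and strip counts *)

Section Routing.
Local Open Scope nat_scope.
Variables (n m K B B' : nat) (cx cy : 'I_n -> nat) (d : 'I_n -> 'I_n).

Let cell (i : 'I_n) := (cx i, cy i).
Let hx i := home m (cx i).
Let hy i := home m (cy i).

Hypotheses (m_gt1 : 1 < m) (K_gt0 : 0 < K).
Hypothesis d_neq : forall i, d i != i.
Hypothesis in_disk : forall i, (extent m (cx i)).-1 ^ 2 + (extent m (cy i)).-1 ^ 2 <= m ^ 2.
Hypothesis relays : forall C, inside m C -> exists i, cell i = C.
Hypothesis src_col : forall k, #|[set i | hx i == k]| <= B.
Hypothesis src_row : forall k, #|[set i | hy i == k]| <= B.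
Hypothesis dst_col : forall k, #|[set i | hx (d i) == k]| <= B'.
Hypothesis dst_row : forall k, #|[set i | hy (d i) == k]| <= B'.

(** The source transmits from its own cell, which may differ from its home cell where the path
    starts; hence the first alternative. *)
Definition crossing (C : nat * nat) : {set 'I_n} :=
  [set i | (cell i == C) || cross (hx i, hy i) (hx (d i), hy (d i)) C].

(** The third B counts the sources lying in C itself: their homes are all in column [home m C.1]. *)
Lemma card_crossing C : #|crossing C| <= 3 * B + 2 * B'.
Proof.
have sub : crossing C \subset
    [set i | hx i == home m C.1] :|: ([set i | hx i == C.1] :|: [set i | hy i == C.2])
    :|: ([set i | hx (d i) == C.1] :|: [set i | hy (d i) == C.2]).
  apply/fintype.subsetP => i; rewrite !inE /cross /= => /orP[/eqP<-|].
    by rewrite /= eqxx.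
  by case/or4P => /eqP ->; rewrite eqxx ?orbT.
apply: (leq_trans (subset_leq_card sub)).
have cU (A1 A2 : {set 'I_n}) a1 a2 : #|A1| <= a1 -> #|A2| <= a2 -> #|A1 :|: A2| <= a1 + a2.
  move=> h1 h2; apply: (leq_trans (_ : _ <= #|A1| + #|A2|)); last exact: leq_add.
  by rewrite cardsU leq_subr.
have := cU _ _ _ _ (cU _ _ _ _ (src_col (home m C.1)) (cU _ _ _ _ (src_col C.1) (src_row C.2)))
  (cU _ _ _ _ (dst_col C.1) (dst_row C.2)).
by move/leq_trans; apply; lia.
Qed.

Let hop (i j : 'I_n) := cell_near 2 (cell i) (cell j).

(** One relay per cell is shared by all routes, so the cell, the route and whether the source is
    transmitting determine the transmitter. The option type leaves empty cells without a relay. *)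
Lemma relay_map : exists rel : nat * nat -> option 'I_n,
  forall C, inside m C -> exists2 k, rel C = Some k & cell k = C.
Proof.
exists (fun C => [pick i | cell i == C]) => C /relays[i iC].
case: pickP => [k /eqP kC|/(_ i)]; first by exists k.
by rewrite iC eqxx.
Qed.

(* The source and the destination may themselves be relays of traversed cells;
   [shorten] removes the resulting repetitions. *)
Lemma node_route (rel : nat * nat -> option 'I_n) (i : 'I_n) :
  (forall C, inside m C -> exists2 k, rel C = Some k & cell k = C) ->
  exists p : seq 'I_n, [/\ path hop i p, last i p = d i, uniq (i :: p) &
    all (fun k => (k == d i) || (rel (cell k) == Some k) && (i \in crossing (cell k))) p].
Proof.
move=> relP.
have home_in k : inside m (hx k, hy k) by apply: home_inside.
have [p [pp lp ap]] := inside_path _ _ _ (home_in i) (home_in (d i)).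
pose r C := odflt i (rel C).
have rP C : inside m C -> cell (r C) = C /\ rel C = Some (r C).
  by rewrite /r => /relP[k -> kC].
pose p0 := (hx i, hy i) :: p.
have ap0 : all (fun C => inside m C && cross (hx i, hy i) (hx (d i), hy (d i)) C) p0.
  by rewrite /= home_in ap /cross /= eqxx.
(* The first and last hops join a node to the relay of its home cell, at most two cells away; this
   is why hops have range 2 while the cell path has steps of range 1. *)
pose q := rcons (map r p0) (d i).
have pq : path hop i q.
  rewrite /q rcons_path; apply/andP; split.
    rewrite /=; apply/andP; split.
      rewrite /hop (rP _ (home_in i)).1 /cell_near /= !home_dist //; exact: ltnW.
    rewrite path_map.
    have : all (inside m) ((hx i, hy i) :: p).
      by apply: sub_all ap0 => C /andP[].
    move=> al; apply: (sub_in_path (P := inside m)) pp => //.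
    move=> C D /rP[CC _] /rP[DD _]; rewrite /hop /= CC DD.
    by rewrite /cell_near; lia.
  rewrite /= last_map lp /hop (rP _ (home_in _)).1 /cell_near /=.
  have := home_dist m (cx (d i)) (ltnW m_gt1); have := home_dist m (cy (d i)) (ltnW m_gt1).
  by rewrite /dist_nat /hx /hy; lia.
have lq : last i q = d i by rewrite last_rcons.
have aq : all (fun k => (k == d i) || (rel (cell k) == Some k) && (i \in crossing (cell k))) q.
  rewrite all_rcons eqxx andTb all_map; apply: sub_all ap0 => C /andP[/rP[CC rC] cC] /=.
  by rewrite CC rC eqxx inE cC !orbT.
case: (shortenP pq) lq => q' pq' uq' sub lq'.
exists q'; split => //; apply/allP => k /sub; exact: (allP aq).
Qed.

Lemma choose_routes (rel : nat * nat -> option 'I_n) :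
  (forall C, inside m C -> exists2 k, rel C = Some k & cell k = C) ->
  exists p : 'I_n -> seq 'I_n, forall i, [/\ path hop i (p i), last i (p i) = d i, uniq (i :: p i) &
    all (fun k => (k == d i) || (rel (cell k) == Some k) && (i \in crossing (cell k))) (p i)].
Proof.
move=> relP; have [p pP] := boolp.choice (fun i => node_route rel i relP).
by exists p.
Qed.

Lemma nth_belast (T : eqType) (x0 x : T) p j : j < size p ->
  nth x0 (belast x p) j = nth x0 (x :: p) j.
Proof.
by move=> jp; rewrite lastI nth_rcons size_belast jp.
Qed.

(* Mixed-radix code of the cell modulo K in each coordinate, of whether k
   transmits as the source of route i or as a relay, and of the rank of i among
   the routes crossing the cell; it determines the hop once the cell is known. *)
Definition slot (i k : 'I_n) : nat :=
  (cx k %% K + K * (cy k %% K + K * ((k == i) + 2 * index i (enum (crossing (cell k)))))).+1.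

Lemma slot_inj i k i' k' : slot i k = slot i' k' ->
  [/\ cx k = cx k' %[mod K], cy k = cy k' %[mod K], (k == i) = (k' == i') &
      index i (enum (crossing (cell k))) = index i' (enum (crossing (cell k')))].
Proof.
have base b x y x' y' : 0 < b -> x < b -> x' < b -> x + b * y = x' + b * y' -> x = x' /\ y = y'.
  move=> b0 xb xb' e.
  have ex : x = x'.
    by have := congr1 (modn^~ b) e; rewrite /= (addnC x) (addnC x') ![b * _]mulnC !modnMDl !modn_small.
  split=> //; move: e; rewrite ex => /addnI /eqP; rewrite eqn_mul2l; lia.
move=> [] /base[]; rewrite ?ltn_mod // => ex /base[]; rewrite ?ltn_mod // => ey.
move=> /base[] //; try by case: (_ == _).
move=> ef ei; split => //; by move: ef; case: (k == i); case: (k' == i').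
Qed.

Lemma slot_le i k : i \in crossing (cell k) -> slot i k <= K * K * (2 * (3 * B + 2 * B')).
Proof.
move=> ik; have := card_crossing (cell k); rewrite /slot.
have : index i (enum (crossing (cell k))) < #|crossing (cell k)|.
  by rewrite cardE index_mem mem_enum.
move: (index _ _) #|_| => a b ab bB.
have ub : a < 3 * B + 2 * B' by lia.
move: (3 * B + 2 * B') ub => T aT.
have := ltn_pmod (cx k) K_gt0; have := ltn_pmod (cy k) K_gt0.
move: (cx k %% K) (cy k %% K) => x y yK xK.
have h1 : (k == i) + 2 * a <= (2 * T).-1 by case: (k == i); lia.
move: h1; set f := (k == i) + 2 * a => h1.
have h2 : y + K * f < K * (2 * T) by nia.
have h3 : x + K * (y + K * f) < K * (K * (2 * T)) by nia.
by rewrite -mulnA.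
Qed.

Lemma routing : exists S : system n,
  [/\ is_system d S, period S <= K * K * (2 * (3 * B + 2 * B')),
      forall i j, j < nhops (S i) -> cell_near 2 (cell (htx i (S i) j)) (cell (hrx i (S i) j)) &
      forall i1 i2 j1 j2, j1 < nhops (S i1) -> j2 < nhops (S i2) ->
        hslot (S i1) j1 = hslot (S i2) j2 -> htx i1 (S i1) j1 <> htx i2 (S i2) j2 ->
        [/\ cell (htx i1 (S i1) j1) <> cell (htx i2 (S i2) j2),
            cx (htx i1 (S i1) j1) = cx (htx i2 (S i2) j2) %[mod K] &
            cy (htx i1 (S i1) j1) = cy (htx i2 (S i2) j2) %[mod K]]].
Proof.
have [rel relP] := relay_map; have [p pP] := choose_routes rel relP.
pose S : system n := fun i => SRoute (i :: p i) (map (slot i) (belast i (p i))).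
exists S.
have nh i : nhops (S i) = size (p i) by rewrite /nhops size_map size_belast.
have hs i j : j < size (p i) -> hslot (S i) j = slot i (htx i (S i) j).
  by move=> jp; rewrite /hslot /= (nth_map i) ?size_belast // nth_belast.
(* A transmitter is the source or the relay of its cell: the destination occurs only at the end of
   the repetition-free node list, and never transmits. *)
have txP i j : j < size (p i) -> let k := htx i (S i) j in
    i \in crossing (cell k) /\ ((k == i) || (rel (cell k) == Some k)).
  have [_ lp up /allP ap] := pP i.
  move=> jp; rewrite /htx /=; case: j jp => [|j] jp; first by rewrite /= inE !eqxx.
  have jp' : j < size (p i) by exact: ltnW.
  have /ap := mem_nth i jp' => /= /orP[/eqP e|/andP[-> ->]]; last by rewrite orbT.
  have : nth i (i :: p i) j.+1 = nth i (i :: p i) (size (p i)).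
    by rewrite /= e -lp -nth_last; case: (p i) jp.
  by move/eqP; rewrite nth_uniq //= ?ltnS ?(ltnW jp) // => /eqP e'; rewrite e' ltnn in jp.
(* Within a cell, the rank digit gives the route, the source flag together with the shared relay
   gives the node, and absence of repetition gives the position. Compatibility and separation both
   follow. *)
have same i1 i2 j1 j2 : j1 < size (p i1) -> j2 < size (p i2) ->
    hslot (S i1) j1 = hslot (S i2) j2 ->
    cell (htx i1 (S i1) j1) = cell (htx i2 (S i2) j2) -> (i1, j1) = (i2, j2).
  move=> j1p j2p; rewrite !hs // => /slot_inj[_ _ ef ei] ec.
  have [c1 r1] := txP _ _ j1p; have [c2 r2] := txP _ _ j2p.
  have ei12 : i1 = i2.
    rewrite -(nth_index i1 (s := enum (crossing (cell (htx i1 (S i1) j1)))) (x := i1)) ?mem_enum //.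
    by rewrite ei ec nth_index ?mem_enum.
  subst i2; congr pair.
  have [_ _ up _] := pP i1.
  have ek : htx i1 (S i1) j1 = htx i1 (S i1) j2.
    move: ef r1 r2; case: eqP => [->|_]; first by move=> /esym/eqP ->.
    by move=> /esym -> /= /eqP r1 /eqP; rewrite -ec r1 => -[].
  by move/eqP: ek; rewrite nth_uniq //= ?ltnS ?(ltnW j1p) ?(ltnW j2p) // => /eqP.
split.
- split => [i|]; last first.
    move=> i1 i2 j1 j2; rewrite !nh => j1p j2p ne es et; apply: ne.
    by apply: same => //; rewrite et.
  have [pp lp up ap] := pP i; split => //.
  + by rewrite nh.
  + rewrite nh; case: (p i) lp => [/= e|//].
    by have := d_neq i; rewrite -e eqxx.
  + by rewrite /= all_map; apply/allP.
- apply/bigmax_leqP => i _; rewrite (big_nth 0) big_mkord; apply/bigmax_leqP => j _.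
  have jp : j < size (p i) by rewrite -(nh i); exact: (ltn_ord j).
  rewrite -/(hslot (S i) j) hs //; apply: slot_le.
  by have [] := txP _ _ jp.
- move=> i j; rewrite nh => jp; have [pp _ _ _] := pP i.
  by have /(pathP i) := pp => /(_ _ jp).
- move=> i1 i2 j1 j2; rewrite !nh => j1p j2p es et; split.
  + by move=> ec; apply: et; case: (same _ _ _ _ j1p j2p es ec) => -> ->.
  + by move: es; rewrite !hs // => /slot_inj[].
  + by move: es; rewrite !hs // => /slot_inj[].
Qed.

End Routing.

(** * Interference *)

Section Interference.
Variable R : realType.
Implicit Types (s a : R) (N K : nat).

Lemma sum_inj_le (I J : finType) (P : pred I) (Q : pred J) (h : I -> J) (F : J -> R) :
  (forall j, 0 <= F j) -> {in P &, injective h} -> (forall i, P i -> Q (h i)) ->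
  \sum_(i | P i) F (h i) <= \sum_(j | Q j) F j.
Proof.
move=> F0 hinj PQ.
rewrite -(big_imset F (A := P) (h := h)) // (bigID (mem (h @: P)) Q) /=.
rewrite [X in X <= _](eq_bigl (fun j => Q j && (j \in h @: P))).
  by rewrite lerDl sumr_ge0.
move=> j /=; case: imsetP => [[i iP ->]|]; last by rewrite andbF.
by rewrite PQ.
Qed.

(** The value 1 at q = 0 accounts for cells in the same row or column as the transmitter. *)
Definition weight s (q : nat) : R := ((maxn 1 q)%:R `^ s)^-1.

Lemma weight_ge0 s q : 0 <= weight s q.
Proof. by rewrite /weight invr_ge0 powR_ge0. Qed.

Lemma weight_le s p q : 0 <= s -> (p <= q)%N -> weight s q <= weight s p.
Proof.
move=> s0 pq; rewrite /weight lef_pV2 ?posrE ?powR_gt0 ?ltr0n ?leq_max //.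
rewrite ge0_ler_powR ?nnegrE ?ler0n // ler_nat; lia.
Qed.

(* Condensation: the terms 2j and 2j+1 together are at most 2 (2j)^-s, so
   S (2N+1) <= 1 + 2^(1-s) S N. *)
Lemma sum_weight_le s : 1 < s -> exists2 Z, 0 < Z & forall N, \sum_(q < N) weight s q <= Z.
Proof.
move=> s1; have s0 : 0 <= s by lra.
pose S N := \sum_(1 <= q < N.+1) weight s q.
have t2 : 2 * (2 `^ s)^-1 < 1 :> R.
  rewrite ltr_pdivrMr ?powR_gt0 // mul1r /powR gt_eqF // -[X in X < _]lnK ?posrE //.
  by rewrite ltr_expR ltr_pMl // ln_gt0 // ltr1n.
have w2 q : (0 < q)%N -> weight s (2 * q) = (2 `^ s)^-1 * weight s q.
  move=> q0; rewrite /weight (maxn_idPr _) ?(maxn_idPr _) //; last by lia.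
  by rewrite natrM powRM ?ler0n // invfM.
have Srec N : S N.+1 = S N + weight s N.+1 by rewrite /S big_nat_recr.
have SS N : S (2 * N).+1 <= 1 + 2 * (2 `^ s)^-1 * S N.
  elim: N => [|N IH].
    by rewrite /S muln0 big_nat1 big_geq // mulr0 addr0 /weight maxnn powR1 invr1.
  have -> : (2 * N.+1).+1 = (2 * N).+3 by lia.
  have e : (2 * N).+2 = (2 * N.+1)%N by lia.
  have h : weight s (2 * N).+3 <= weight s (2 * N).+2 by apply: weight_le.
  rewrite !Srec e in h *; rewrite w2 // in h *; rewrite Srec in IH; lra.
have Sle N : S N <= S (2 * N).+1.
  rewrite /S (big_cat_nat (n := N.+1) (p := (2 * N).+2)) //=; last by lia.
  by rewrite lerDl sumr_ge0 // => q _; exact: weight_ge0.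
exists (1 + (1 - 2 * (2 `^ s)^-1)^-1); first by rewrite addr_gt0 // invr_gt0 subr_gt0.
move=> N; have SN : S N <= (1 - 2 * (2 `^ s)^-1)^-1.
  rewrite -[X in _ <= X]mul1r ler_pdivlMr ?subr_gt0 //.
  have := le_trans (Sle N) (SS N); lra.
apply: (le_trans (_ : _ <= \sum_(0 <= q < N.+1) weight s q)).
  by rewrite big_nat_recr //= big_mkord lerDl weight_ge0.
rewrite big_nat_recl //= /weight maxn0 powR1 invr1 lerD2l.
apply: le_trans SN; rewrite /S big_add1 /=; by rewrite le_refl.
Qed.

(** On either side of u, dividing the distance by K is injective on the residue class, so each side
    costs at most one full series. *)
Lemma sum_congruent_le s (Z : R) : (forall N, \sum_(q < N) weight s q <= Z) ->
  forall K N u, (0 < K)%N ->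
  \sum_(v < N | v == u %[mod K]) weight s (dist_nat v u %/ K) <= Z + Z.
Proof.
move=> ZP K N u K0.
rewrite (bigID (fun v : 'I_N => (u <= v)%N)) /=; apply: lerD.
- pose h (v : 'I_N) : 'I_N.+1 := inord ((v - u) %/ K).
  have hE (v : 'I_N) : nat_of_ord (h v) = ((v - u) %/ K)%N.
    rewrite /h inordK //; have := leq_div (v - u) K; have := ltn_ord v; lia.
  apply: le_trans (ZP N.+1).
  rewrite (eq_bigr (fun v => weight s (h v))).
    apply: (@sum_inj_le _ _ _ predT h (fun q : 'I_N.+1 => weight s q)) => //.
      by move=> q; exact: weight_ge0.
    move=> v v' /andP[ev uv] /andP[ev' uv'] /(congr1 val) /=; rewrite !hE => e.
    apply: val_inj => /=; rewrite eqn_mod_dvd // in ev; rewrite eqn_mod_dvd // in ev'.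
    have := divnK ev; have := divnK ev'; rewrite e; lia.
  by move=> v /andP[_ uv]; rewrite hE /dist_nat; congr (weight s (_ %/ K)); lia.
- pose h (v : 'I_N) : 'I_u.+1 := inord ((u - v) %/ K).
  have hE (v : 'I_N) : nat_of_ord (h v) = ((u - v) %/ K)%N.
    rewrite /h inordK //; have := leq_div (u - v) K; lia.
  apply: le_trans (ZP u.+1).
  rewrite (eq_bigr (fun v => weight s (h v))).
    apply: (@sum_inj_le _ _ _ predT h (fun q : 'I_u.+1 => weight s q)) => //.
      by move=> q; exact: weight_ge0.
    move=> v v' /andP[ev]; rewrite -ltnNge => uv /andP[ev']; rewrite -ltnNge => uv'.
    move=> /(congr1 val) /=; rewrite !hE => e.
    rewrite eq_sym eqn_mod_dvd ?(ltnW uv) // in ev.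
    rewrite eq_sym eqn_mod_dvd ?(ltnW uv') // in ev'.
    apply: val_inj => /=; have := divnK ev; have := divnK ev'; rewrite e; lia.
  by move=> v /andP[_]; rewrite -ltnNge => uv; rewrite hE /dist_nat; congr (weight s (_ %/ K)); lia.
Qed.

Lemma dist2_ge_x (x y : R * R) : `|x.1 - y.1| <= dist2 x y.
Proof.
rewrite /dist2 -sqrtr_sqr ler_sqrt ?lerDl ?sqr_ge0 //.
by rewrite addr_ge0 ?sqr_ge0.
Qed.

Lemma dist2_ge_y (x y : R * R) : `|x.2 - y.2| <= dist2 x y.
Proof.
rewrite /dist2 -sqrtr_sqr ler_sqrt ?lerDr ?sqr_ge0 //.
by rewrite addr_ge0 ?sqr_ge0.
Qed.

Lemma dist2_le (x y : R * R) : dist2 x y <= `|x.1 - y.1| + `|x.2 - y.2|.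
Proof.
have h : 0 <= `|x.1 - y.1| + `|x.2 - y.2| by rewrite addr_ge0.
rewrite /dist2 -[X in _ <= X](ger0_norm h) -sqrtr_sqr ler_sqrt ?sqr_ge0 //.
rewrite [X in _ <= X]sqrrD !real_normK ?num_real //.
by rewrite -addrA [X in _ <= _ + X]addrC addrA lerDl mulrn_wge0 // mulr_ge0.
Qed.

Lemma eta_le (alpha x y : R) : 0 <= alpha -> 0 <= x -> x <= y -> Defs.eta alpha y <= Defs.eta alpha x.
Proof.
move=> a0 x0 xy; rewrite /Defs.eta lef_pV2 ?posrE ?powR_gt0 //; try lra.
by rewrite ge0_ler_powR ?nnegrE //; lra.
Qed.

(* max(p, q)^alpha dominates p^(alpha/2) q^(alpha/2), so that the sum over cells
   splits into a product of two one-dimensional sums. *)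
Lemma interference_term (alpha a D : R) (K p q : nat) :
  0 < alpha -> 0 < a -> (6 <= K)%N -> (0 < maxn p q)%N ->
  a * ((K * p)%:R - 3) <= D -> a * ((K * q)%:R - 3) <= D ->
  Defs.eta alpha D <= ((K%:R / 2 * a) `^ alpha)^-1 * (weight (alpha / 2) p * weight (alpha / 2) q).
Proof.
move=> al0 a0 K6 pq0 Dp Dq.
have K6' : 6 <= K%:R :> R by rewrite (ler_nat _ 6).
wlog pq : p q pq0 Dp Dq / (p <= q)%N.
  move=> H; have [|/ltnW] := leqP p q; first exact: H.
  by rewrite [X in _ * X]mulrC; apply: H => //; rewrite maxnC.
have q0 : (0 < q)%N by lia.
have q1 : 1 <= q%:R :> R by rewrite ler1n.
(* Since K q >= 6, subtracting 3 removes at most half of K q. *)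
have Dge : K%:R / 2 * a * q%:R <= D.
  apply: le_trans Dq; rewrite natrM -subr_ge0.
  have -> : a * (K%:R * q%:R - 3) - K%:R / 2 * a * q%:R = a * (K%:R / 2 * q%:R - 3) by field.
  rewrite mulr_ge0 ?(ltW a0) // subr_ge0.
  have : 6 * 1 <= K%:R * q%:R :> R by apply: ler_pM.
  lra.
have b0 : 0 < K%:R / 2 * a * q%:R by rewrite !mulr_gt0 //; lra.
apply: (le_trans (_ : _ <= ((K%:R / 2 * a * q%:R) `^ alpha)^-1)).
  rewrite /Defs.eta lef_pV2 ?posrE ?powR_gt0 //; last by lra.
  by rewrite ge0_ler_powR ?nnegrE //; lra.
rewrite powRM ?invfM; [|by rewrite mulr_ge0 ?ltW //; lra|lra].
apply: ler_wpM2l; first by rewrite invr_ge0 powR_ge0.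
have -> : (q%:R `^ alpha)^-1 = weight (alpha / 2) q * weight (alpha / 2) q :> R.
  rewrite /weight (maxn_idPr q0) -invfM -powRD; last by rewrite pnatr_eq0; lia.
  by congr (_ `^ _)^-1; lra.
by apply: ler_wpM2r; [exact: weight_ge0|apply: weight_le => //; lra].
Qed.

Lemma eq_mod_dist (K u v : nat) : u = v %[mod K] -> dist_nat u v = (K * (dist_nat u v %/ K))%N.
Proof.
move=> e; rewrite mulnC divnK // /dist_nat.
have [uv|/ltnW uv] := leqP u v.
  by move/eqP: e; rewrite eq_sym eqn_mod_dvd // (_ : u - v = 0)%N //; lia.
by move/eqP: e; rewrite eqn_mod_dvd // (_ : v - u = 0)%N ?addn0 //; lia.
Qed.

(** Interferers occupy distinct cells, all congruent modulo K to that of t, so their sum is at most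
    the sum over all congruent cells, which factors into two one-dimensional sums. *)
Lemma interference_le (alpha a Z : R) (n K : nat) (cx cy : 'I_n -> nat) (pos : 'I_n -> R * R)
  (t r : 'I_n) (T : pred 'I_n) :
  0 < alpha -> 0 < a -> (6 <= K)%N ->
  (forall N, \sum_(q < N) weight (alpha / 2) q <= Z) ->
  (forall i j, a * ((dist_nat (cx i) (cx j))%:R - 1) <= `|(pos i).1 - (pos j).1|) ->
  (forall i j, a * ((dist_nat (cy i) (cy j))%:R - 1) <= `|(pos i).2 - (pos j).2|) ->
  cell_near 2 (cx t, cy t) (cx r, cy r) ->
  (forall k, T k -> [/\ (cx k, cy k) <> (cx t, cy t), cx k = cx t %[mod K] & cy k = cy t %[mod K]]) ->
  {in T &, injective (fun k => (cx k, cy k))} ->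
  \sum_(k < n | T k) Defs.eta alpha (dist2 (pos k) (pos r)) <=
    ((K%:R / 2 * a) `^ alpha)^-1 * ((Z + Z) * (Z + Z)).
Proof.
move=> al0 a0 K6 ZP gx gy tr TP Tinj.
have K0 : (0 < K)%N by lia.
set A := (_ `^ _)^-1; have A0 : 0 <= A by rewrite invr_ge0 powR_ge0.
pose F (C : nat * nat) := weight (alpha / 2) (dist_nat C.1 (cx t) %/ K) *
                          weight (alpha / 2) (dist_nat C.2 (cy t) %/ K).
(* The loss of 3 is 2 for the offset between the cells of t and r, plus 1 for the positions within
   the cells. *)
have far (g : 'I_n -> nat) (x : 'I_n -> R) k : (forall i j, a * ((dist_nat (g i) (g j))%:R - 1) <= `|x i - x j|) ->
    (dist_nat (g t) (g r) <= 2)%N -> g k = g t %[mod K] ->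
    a * ((K * (dist_nat (g k) (g t) %/ K))%:R - 3) <= `|x k - x r|.
  move=> gP gr gk; rewrite -eq_mod_dist //; apply: le_trans (gP k r); rewrite ler_pM2l //.
  have : (dist_nat (g k) (g t) <= dist_nat (g k) (g r) + 2)%N by move: gr; rewrite /dist_nat; lia.
  rewrite -(ler_nat R) natrD; lra.
have /andP[/= trx try] := tr.
apply: (le_trans (_ : _ <= \sum_(k < n | T k) A * F (cx k, cy k))).
  apply: ler_sum => k Tk; have [ne ex ey] := TP k Tk.
  apply: interference_term => //.
  - rewrite -(ltn_pmul2l K0) muln0 maxnMr -!eq_mod_dist //.
    have : cx k <> cx t \/ cy k <> cy t.
      by have [e|] := eqVneq (cx k) (cx t); [right => e'; apply: ne; rewrite e e'|left; exact/eqP].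
    by rewrite /dist_nat /=; move: (cx k) (cx t) (cy k) (cy t); clear; lia.
  - apply: le_trans (dist2_ge_x _ _); exact: (far cx (fun i => (pos i).1)).
  - apply: le_trans (dist2_ge_y _ _); exact: (far cy (fun i => (pos i).2)).
rewrite -mulr_sumr; apply: ler_wpM2l => //.
(* Any bound on the indices would do; it makes the set of cells finite. *)
pose N := (\max_(i < n) maxn (cx i) (cy i)).+1.
have cN i : (cx i < N)%N /\ (cy i < N)%N.
  have : (maxn (cx i) (cy i) < N)%N by exact: (@leq_bigmax _ (fun i : 'I_n => maxn (cx i) (cy i)) i).
  by move: N (cx i) (cy i); clear; lia.
pose h (k : 'I_n) : 'I_N * 'I_N := (inord (cx k), inord (cy k)).
have hx k : nat_of_ord (h k).1 = cx k by rewrite /= inordK //; case: (cN k).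
have hy k : nat_of_ord (h k).2 = cy k by rewrite /= inordK //; case: (cN k).
rewrite (eq_bigr (fun k => F (nat_of_ord (h k).1, nat_of_ord (h k).2))); last first.
  by move=> k _; rewrite hx hy.
pose G (C : 'I_N * 'I_N) := F (nat_of_ord C.1, nat_of_ord C.2).
have := @sum_inj_le _ _ T (fun C : 'I_N * 'I_N => (C.1 == cx t %[mod K]) && (C.2 == cy t %[mod K])) h G.
move=> /(_ _ _ _)/le_trans; apply.
- by move=> C; rewrite /G /F mulr_ge0 ?weight_ge0.
- move=> k k' Tk Tk' e; apply: Tinj => //; congr pair.
    by rewrite -hx -(hx k') e.
  by rewrite -hy -(hy k') e.
- by move=> k /TP[_ e1 e2]; rewrite hx hy e1 e2 !eqxx.
rewrite /G /F /= -(pair_big (fun u : 'I_N => u == cx t %[mod K]) (fun v : 'I_N => v == cy t %[mod K])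
  (fun u v : 'I_N => weight (alpha / 2) (dist_nat u (cx t) %/ K) * weight (alpha / 2) (dist_nat v (cy t) %/ K))) /=.
under eq_bigr do rewrite -mulr_sumr.
rewrite -mulr_suml; apply: ler_pM; try (apply: sumr_ge0 => *; exact: weight_ge0).
  exact: sum_congruent_le.
exact: sum_congruent_le.
Qed.

End Interference.

Arguments weight {R} s q.

(** * Success under the SINR criterion *)

(** Noise and interference are each allowed half of the budget P e / beta. *)
Lemma sinr_intro (R : realType) (beta No P G I e : R) :
  0 < beta -> 0 < No -> 0 < P -> 0 <= I -> e <= G ->
  2 * beta * No <= P * e -> 2 * beta * I <= e -> beta <= P * G / (No + P * I).
Proof.
move=> b0 No0 P0 I0 eG h1 h2.
have PI : 0 <= P * I by rewrite mulr_ge0 // ltW.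
rewrite ler_pdivlMr; last by lra.
have : P * e <= P * G by rewrite ler_pM2l.
have : P * (2 * beta * I) <= P * e by rewrite ler_pM2l.
lra.
Qed.

Lemma transmitsP n (S : system n) sig k :
  reflect (exists i j, [/\ (j < nhops (S i))%N, htx i (S i) j = k & hslot (S i) j = sig])
          (transmits S sig k).
Proof.
apply: (iffP existsP) => [[i /hasP[j]]|[i [j [jn <- <-]]]].
  rewrite mem_iota add0n => /andP[_ jn] /andP[/eqP ek /eqP es].
  by exists i, j.
exists i; apply/hasP; exists j; first by rewrite mem_iota.
by rewrite !eqxx.
Qed.

Lemma successful_of_separation (R : realType) (alpha beta : R) : 2 < alpha -> 0 < beta ->
  exists2 K : nat, (0 < K)%N & forall (n : nat) (a No P : R) (pos : 'I_n -> R * R)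
    (cx cy : 'I_n -> nat) (S : system n),
  1 / 3 <= a -> 0 < No -> 2 * beta * No * (1 + 6 * a) `^ alpha <= P ->
  (forall i j, a * ((dist_nat (cx i) (cx j))%:R - 1) <= `|(pos i).1 - (pos j).1|
                 <= a * ((dist_nat (cx i) (cx j))%:R + 1)) ->
  (forall i j, a * ((dist_nat (cy i) (cy j))%:R - 1) <= `|(pos i).2 - (pos j).2|
                 <= a * ((dist_nat (cy i) (cy j))%:R + 1)) ->
  (forall i j, (j < nhops (S i))%N -> cell_near 2 (cx (htx i (S i) j), cy (htx i (S i) j))
                                                (cx (hrx i (S i) j), cy (hrx i (S i) j))) ->
  (forall i1 i2 j1 j2, (j1 < nhops (S i1))%N -> (j2 < nhops (S i2))%N ->
     hslot (S i1) j1 = hslot (S i2) j2 -> htx i1 (S i1) j1 <> htx i2 (S i2) j2 ->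
     [/\ (cx (htx i1 (S i1) j1), cy (htx i1 (S i1) j1)) <>
           (cx (htx i2 (S i2) j2), cy (htx i2 (S i2) j2)),
         cx (htx i1 (S i1) j1) = cx (htx i2 (S i2) j2) %[mod K] &
         cy (htx i1 (S i1) j1) = cy (htx i2 (S i2) j2) %[mod K]]) ->
  successful alpha beta No P pos S.
Proof.
move=> al2 b0; have al0 : 0 < alpha by lra.
have [Z Z0 ZP] : exists2 Z : R, 0 < Z & forall N, \sum_(q < N) weight (alpha / 2) q <= Z.
  by apply: sum_weight_le; lra.
pose Q := 2 * beta * ((Z + Z) * (Z + Z)).
have Q0 : 0 < Q by rewrite !mulr_gt0 ?addr_gt0.
(* With K = 18 k0, the bound on the interference involves (k0 * 9 a)^-alpha. Here k0^alpha >= k0 >=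
   Q absorbs the constants, and 9 a >= 1 + 6 a because a >= 1/3. *)
pose k0 := (Num.truncn Q).+1.
have k0Q : Q <= k0%:R by apply: ltW; exact: truncnS_gt.
have k01 : 1 <= k0%:R :> R by rewrite ler1n.
exists (18 * k0)%N; first by rewrite muln_gt0.
set K := (18 * k0)%N => n a No P pos cx cy S a3 No0 PP gx gy near sep i j jn.
have a0 : 0 < a by lra.
have P0 : 0 < P by apply: lt_le_trans PP; rewrite !mulr_gt0 // powR_gt0; lra.
set t := htx _ _ _; set r := hrx _ _ _; set sig := hslot _ _.
pose T : pred 'I_n := fun k => (k != t) && transmits S sig k.
pose I := \sum_(k < n | T k) Defs.eta alpha (dist2 (pos k) (pos r)).
rewrite /sinr_ok -mulr_sumr -[\sum_(k < n | _) _]/I.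
have e0 : 0 < 1 + 6 * a by lra.
have inter : I <= ((K%:R / 2 * a) `^ alpha)^-1 * ((Z + Z) * (Z + Z)).
  apply: (@interference_le _ alpha a Z n K cx cy pos t r T) => //.
  - by rewrite (@leq_trans (18 * 1)) // leq_mul2l.
  - by move=> k l; case/andP: (gx k l).
  - by move=> k l; case/andP: (gy k l).
  - exact: near.
  - move=> k /andP[/eqP kt /transmitsP[i' [j' [jn' ek es]]]].
    by rewrite -ek in kt *; apply: sep.
  - move=> k k' /andP[_ /transmitsP[i1 [j1 [jn1 ek1 es1]]]] /andP[_ /transmitsP[i2 [j2 [jn2 ek2 es2]]]] ec.
    apply: contrapT => ne.
    by have [] := sep i1 i2 j1 j2 jn1 jn2 (etrans es1 (esym es2)); rewrite ek1 ek2 // ec.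
apply: (@sinr_intro _ beta No P _ I (((1 + 6 * a) `^ alpha)^-1)) => //.
- by apply: sumr_ge0 => k _; rewrite /Defs.eta invr_ge0 powR_ge0.
(* Cells at most two apart put the ends of a hop within 3 a in each coordinate, hence within 6 a of
   each other. *)
- have := near _ _ jn; rewrite -/t -/r => /andP[/= nx ny].
  have ux : `|(pos t).1 - (pos r).1| <= 3 * a.
    case/andP: (gx t r) => _ /le_trans; apply; rewrite mulrC ler_pM2r //.
    by move: nx; rewrite -(ler_nat R); lra.
  have uy : `|(pos t).2 - (pos r).2| <= 3 * a.
    case/andP: (gy t r) => _ /le_trans; apply; rewrite mulrC ler_pM2r //.
    by move: ny; rewrite -(ler_nat R); lra.
  rewrite -/(Defs.eta alpha (6 * a)); apply: eta_le; [lra|exact: sqrtr_ge0|].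
  by have := dist2_le _ (pos t) (pos r); lra.
- by rewrite ler_pdivlMr ?powR_gt0.
- apply: (le_trans (_ : _ <= Q * ((K%:R / 2 * a) `^ alpha)^-1)).
    have -> : Q * ((K%:R / 2 * a) `^ alpha)^-1 =
        2 * beta * (((K%:R / 2 * a) `^ alpha)^-1 * ((Z + Z) * (Z + Z))) by rewrite /Q; ring.
    by rewrite ler_pM2l // mulr_gt0.
  have E1 : K%:R / 2 * a = k0%:R * (9 * a) :> R by rewrite /K natrM; field.
  rewrite E1 powRM; [|lra|lra].
  rewrite invfM mulrA -[X in _ <= X]mul1r.
  apply: ler_pM.
  + by rewrite divr_ge0 ?powR_ge0 // ltW.
  + by rewrite invr_ge0 powR_ge0.
  + have k0p : 0 < k0%:R `^ alpha :> R by apply: powR_gt0; lra.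
    rewrite ler_pdivrMr // mul1r.
    by apply: (le_trans k0Q); apply: le1r_powR => //; lra.
  + rewrite lef_pV2 ?posrE; [|by apply: powR_gt0; lra|by apply: powR_gt0; lra].
    by apply: ge0_ler_powR; rewrite ?nnegrE; lra.
Qed.

(** * Exponential moments for finite product laws *)

Section FiniteProbability.
Variable R : realType.
(** An indicator of mean s has exponential moment 1 + kappa s. *)
Let kappa : R := expR 1 - 1.

Lemma union_bound (X J : finType) (w : X -> R) (bad : J -> pred X) :
  (forall x, 0 <= w x) ->
  \sum_(x | [exists j, bad j x]) w x <= \sum_j \sum_(x | bad j x) w x.
Proof.
move=> w0; rewrite (exchange_big_dep predT) //= [X in X <= _]big_mkcond.
apply: ler_sum => x _; case: existsP => [[j bj]|_]; last by rewrite sumr_ge0.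
by rewrite (bigD1 j) //= lerDl sumr_ge0.
Qed.

Lemma expR_ge1 (x : R) : (1 <= expR x) = (0 <= x).
Proof. by rewrite -[X in X <= _]expR0 ler_expR. Qed.

Section Product.
Variables (I X : finType) (p : I -> X -> R) (s : R) (S : pred X).
Hypothesis p_ge0 : forall i x, 0 <= p i x.
Hypothesis p_sum1 : forall i, \sum_x p i x = 1.

(** Chernoff bound at parameter 1: the indicator of the event is at most exp(count - B), the
    expectation factors, and each factor is at most 1 + kappa s <= exp(kappa s). The law may depend
    on i because a destination avoids its own source. *)
Lemma product_tail (B : nat) : (forall i, \sum_(x | S x) p i x <= s) ->
  \sum_(f : {ffun I -> X} | (B < #|[set i | S (f i)]|)%N) \prod_i p i (f i)
    <= expR (#|I|%:R * (kappa * s) - B%:R).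
Proof.
move=> pS.
have k0 : 0 <= kappa by rewrite subr_ge0 expR_ge1.
apply: (le_trans (_ : _ <= \sum_(f : {ffun I -> X})
          expR (- B%:R) * \prod_i (p i (f i) * expR (S (f i))%:R))).
  rewrite big_mkcond; apply: ler_sum => f _.
  have prod_ge0 : 0 <= \prod_i p i (f i) by apply: prodr_ge0.
  case: ifP => [Bf|_]; last by rewrite mulr_ge0 ?expR_ge0 // prodr_ge0 // => i _; rewrite mulr_ge0 ?expR_ge0.
  rewrite big_split /= -expR_sum mulrCA -expRD ler_peMr // expR_ge1.
  rewrite addrC subr_ge0 -natr_sum ler_nat; apply: (leq_trans (ltnW Bf)).
  by rewrite -sum1dep_card big_mkcond /=; apply: leq_sum => i _; case: (S _).
rewrite -mulr_sumr -(bigA_distr_bigA (fun i x => p i x * expR (S x)%:R)) /=.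
rewrite addrC expRD ler_pM2l ?expR_gt0 // mulrC expRM_natr -prodr_const.
apply: ler_prod => i _; apply/andP; split.
  by apply: sumr_ge0 => x _; rewrite mulr_ge0 ?expR_ge0.
apply: (le_trans (_ : _ <= 1 + kappa * s)); last exact: expR_ge1Dx.
rewrite -[X in _ <= X + _](p_sum1 i) (eq_bigr (fun x => p i x + kappa * (if S x then p i x else 0))).
  by rewrite big_split /= lerD2l -mulr_sumr -big_mkcond ler_wpM2l.
by move=> x _; rewrite /kappa; case: (S x); rewrite ?expR0; ring.
Qed.

(** Each factor is at most 1 - s <= exp(-s). *)
Lemma product_miss : (forall i, s <= \sum_(x | S x) p i x) ->
  \sum_(f : {ffun I -> X} | [forall i, ~~ S (f i)]) \prod_i p i (f i)
    <= expR (- (#|I|%:R * s)).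
Proof.
move=> pS.
rewrite (eq_bigl (fun f : {ffun I -> X} => f \in family (fun i => [pred x | ~~ S x]))) /=; last first.
  by move=> f; apply/forallP/familyP => h i; have := h i; rewrite inE.
rewrite -(bigA_distr_big_dep (fun=> [pred x | ~~ S x]) p) /=.
rewrite -mulrN mulrC expRM_natr -prodr_const; apply: ler_prod => i _.
rewrite sumr_ge0 //=; apply: (le_trans (_ : _ <= 1 - s)); last exact: expR_ge1Dx.
have := p_sum1 i; rewrite (bigID S) /= => e; have := pS i; lra.
Qed.

End Product.


(** * Random placements in finitely many cells, with random destinations *)

Section Placement.
Variables (n : nat) (T J : finType) (q : T -> R) (V : pred T) (S : J -> pred T).
Variables (s v : R) (B B' : nat).
Hypothesis n_gt1 : (1 < n)%N.
Hypothesis q_ge0 : forall x, 0 <= q x.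
Hypothesis q_sum1 : \sum_x q x = 1.
Hypothesis q_target : forall x, V x -> v <= q x.
Hypothesis q_strip : forall j, \sum_(x | S j x) q x <= s.

Definition placement_good (c : {ffun 'I_n -> T}) (d : {ffun 'I_n -> 'I_n}) : bool :=
  [&& [forall x, V x ==> [exists i, c i == x]],
      [forall j, (#|[set i | S j (c i)]| <= B)%N] &
      [forall j, (#|[set i | S j (c (d i))]| <= B')%N]].

Let mu (c : {ffun 'I_n -> T}) : R := \prod_i q (c i).
(* [nu] vanishes as soon as d has a fixed point. *)
Let nu (d : {ffun 'I_n -> 'I_n}) : R := \prod_i (if d i != i then (n.-1)%:R^-1 else 0).

Let mu_ge0 c : 0 <= mu c. Proof. exact: prodr_ge0. Qed.

Let nu_ge0 d : 0 <= nu d.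
Proof. by apply: prodr_ge0 => i _; case: ifP => // _; rewrite invr_ge0. Qed.

Let mu_sum1 : \sum_c mu c = 1.
Proof. by rewrite /mu -(bigA_distr_bigA (fun=> q)) /= big1. Qed.

Let dest_sum1 (i : 'I_n) : \sum_j (if j != i then (n.-1)%:R^-1 else 0) = 1 :> R.
Proof.
rewrite -big_mkcond /= sumr_const -[X in _ *+ X]/(#|predC1 i|) cardC1 card_ord.
by rewrite -[LHS]mulr_natr mulVf // pnatr_eq0; lia.
Qed.

Let nu_sum1 : \sum_d nu d = 1.
Proof.
rewrite /nu -(bigA_distr_bigA (fun i j : 'I_n => if j != i then (n.-1)%:R^-1 else 0)) /=.
by apply: big1 => i _; exact: dest_sum1.
Qed.

Let miss (c : {ffun 'I_n -> T}) : bool := [exists x, V x && [forall i, c i != x]].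
Let crowded (c : {ffun 'I_n -> T}) : bool := [exists j, (B < #|[set i | S j (c i)]|)%N].
Let aimed (c : {ffun 'I_n -> T}) (d : {ffun 'I_n -> 'I_n}) : bool :=
  [exists j, (B' < #|[set i | S j (c (d i))]|)%N].

Let miss_le : \sum_(c | miss c) mu c <= #|T|%:R * expR (- (n%:R * v)).
Proof.
apply: (le_trans (@union_bound _ _ _ _ _)) => //.
rewrite -sum1_card natr_sum mulr_suml; apply: ler_sum => x _; rewrite mul1r.
case Vx : (V x); last by rewrite big_pred0 ?expR_ge0.
have := @product_miss 'I_n T (fun=> q) v (pred1 x) (fun=> q_ge0) (fun=> q_sum1).
rewrite card_ord /=; apply=> i.
by rewrite big_pred1_eq q_target.
Qed.

Let crowded_le : \sum_(c | crowded c) mu c <= #|J|%:R * expR (n%:R * (kappa * s) - B%:R).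
Proof.
apply: (le_trans (@union_bound _ _ _ _ _)) => //.
rewrite -sum1_card natr_sum mulr_suml; apply: ler_sum => j _; rewrite mul1r.
have := @product_tail 'I_n T (fun=> q) s (S j) (fun=> q_ge0) (fun=> q_sum1) B.
by rewrite card_ord; apply.
Qed.

(** With at most B nodes per strip, a given destination falls in a given strip with probability at
    most B / (n-1); the factor 2 comes from n <= 2 (n-1). *)
Let aimed_le c : ~~ crowded c ->
  \sum_(d | aimed c d) nu d <= #|J|%:R * expR (2 * kappa * B%:R - B'%:R).
Proof.
move=> /existsPn cB; apply: (le_trans (@union_bound _ _ _ _ _)) => //.
rewrite -sum1_card natr_sum mulr_suml; apply: ler_sum => j _; rewrite mul1r.
have n0 : 0 < (n.-1)%:R :> R by rewrite ltr0n; lia.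
have := @product_tail 'I_n 'I_n (fun i k => if k != i then (n.-1)%:R^-1 else 0)
  (B%:R / (n.-1)%:R) (fun k => S j (c k)) _ dest_sum1 B'.
move=> /(_ _ _)/le_trans; apply.
- by move=> i k; case: ifP => // _; rewrite invr_ge0.
- move=> i; apply: (le_trans (_ : _ <= \sum_(k | S j (c k)) (n.-1)%:R^-1)).
    by apply: ler_sum => k _; case: ifP => // _; rewrite invr_ge0 ltW.
  rewrite sumr_const -[_ *+ _]mulr_natl ler_pM2r ?invr_gt0 // ler_nat leqNgt.
  by have := cB j; rewrite cardsE.
- rewrite ler_expR lerD2r card_ord.
  have k0 : 0 <= kappa by rewrite subr_ge0 expR_ge1.
  have n2 : n%:R <= 2 * (n.-1)%:R :> R by rewrite -natrM ler_nat; lia.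
  rewrite mulrCA [2 * _]mulrC -[X in _ <= X]mulrA ler_wpM2l //.
  rewrite mulrA ler_pdivrMr // -mulrA [X in _ <= 2 * X]mulrC mulrA ler_wpM2r //.
Qed.

Lemma placement_likely :
  1 - (#|T|%:R * expR (- (n%:R * v)) + #|J|%:R * expR (n%:R * (kappa * s) - B%:R)
       + #|J|%:R * expR (2 * kappa * B%:R - B'%:R))
  <= \sum_(x : {ffun 'I_n -> T} * {ffun 'I_n -> 'I_n}
           | [forall i, x.2 i != i] && placement_good x.1 x.2)
        \prod_i (q (x.1 i) / (n.-1)%:R).
Proof.
have goodE c d : placement_good c d = [&& ~~ miss c, ~~ crowded c & ~~ aimed c d].
  rewrite /placement_good /miss /crowded /aimed !negb_exists; congr [&& _, _ & _].
  - apply: eq_forallb => x; rewrite negb_and negb_forall implybE; congr (_ || _).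
    by apply: eq_existsb => i; rewrite negbK.
  - by apply: eq_forallb => j; rewrite leqNgt.
  - by apply: eq_forallb => j; rewrite leqNgt.
have -> : \sum_(x : {ffun 'I_n -> T} * {ffun 'I_n -> 'I_n}
           | [forall i, x.2 i != i] && placement_good x.1 x.2)
        \prod_i (q (x.1 i) / (n.-1)%:R) =
    \sum_c \sum_(d | placement_good c d) mu c * nu d.
  rewrite pair_big_dep /= big_mkcond [RHS]big_mkcond; apply: eq_bigr => -[c d] _ /=.
  case: (placement_good c d); rewrite ?andbF // andbT /mu /nu -big_split /=.
  case: ifPn => [/forallP h|].
    by apply: eq_bigr => i _; rewrite h.
  by rewrite negb_forall => /existsP[i ni]; rewrite (bigD1 i) //= (negbTE ni) mulr0 mul0r.
have tot : 1 = \sum_c \sum_d mu c * nu d.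
  by under eq_bigr do rewrite -mulr_sumr nu_sum1 mulr1; rewrite mu_sum1.
rewrite [X in X - _]tot lerBlDr.
rewrite -[X in _ <= _ + (X + _)]addr0.
(* The bad mass is bounded for each placement c separately: all of [mu c] is charged when c misses a
   target or is crowded, and otherwise only the tail over destinations. *)
apply: (le_trans (_ : _ <= \sum_c \sum_(d | placement_good c d) mu c * nu d +
    (\sum_(c | miss c) mu c + \sum_(c | crowded c) mu c +
     \sum_c mu c * (#|J|%:R * expR (2 * kappa * B%:R - B'%:R))))); last first.
  by rewrite lerD2l -mulr_suml mu_sum1 mul1r addr0 lerD2r lerD // crowded_le.
rewrite [\sum_(c | miss c) _]big_mkcond [\sum_(c | crowded c) _]big_mkcond /=.
rewrite -!big_split /=; apply: ler_sum => c _.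
rewrite (bigID (fun d => placement_good c d)) /= lerD2l.
have all_le : \sum_(d | ~~ placement_good c d) mu c * nu d <= mu c.
  rewrite -mulr_sumr -[X in _ <= X]mulr1 ler_wpM2l // -nu_sum1.
  by rewrite [X in _ <= X](bigID (fun d => placement_good c d)) /= lerDr sumr_ge0.
have tail0 : 0 <= mu c * (#|J|%:R * expR (2 * kappa * B%:R - B'%:R)).
  by rewrite !mulr_ge0 ?expR_ge0.
case: (boolP (miss c)) => mc.
  by apply: (le_trans all_le); rewrite -addrA lerDl addr_ge0 //; case: ifP.
case: (boolP (crowded c)) => cc.
  by apply: (le_trans all_le); rewrite add0r lerDl.
rewrite !add0r -mulr_sumr ler_wpM2l //.
under eq_bigl do rewrite goodE mc cc /= negbK.
exact: aimed_le.
Qed.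

End Placement.

End FiniteProbability.

Local Open Scope classical_set_scope.

Lemma measure_bigcup_fin (R : realType) d (T : measurableType d) (mu : {measure set T -> \bar R})
  (I : finType) (P : pred I) (F : I -> set T) : (forall i, measurable (F i)) ->
  (forall i j x, P i -> P j -> F i x -> F j x -> i = j) ->
  mu (\bigcup_(i in [set i | P i]) F i) = (\sum_(i | P i) mu (F i))%E.
Proof.
move=> mF disj; rewrite measure_fin_bigcup //.
- have -> : [set i | P i] = [set` [seq i <- index_enum I | P i]].
    by apply/seteqP; split => i /=; rewrite mem_filter mem_index_enum andbT.
  by rewrite -fsbig_seq ?filter_uniq ?index_enum_uniq // big_filter.
- exact: finite_finset.
- by move=> i j Pi Pj [x [ix jx]]; exact: disj ix jx.
Qed.

(** * Areas of cells *)

Section Geometry.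
Variable R : realType.

(* Half-open except for the last one, so that the 2m bands partition
   [-m a, m a]. *)
Definition band (a : R) (m k : nat) : interval R :=
  Interval (BLeft ((k%:R - m%:R) * a)) (BSide (k.+1 != m.*2) ((k.+1%:R - m%:R) * a)).

Definition cell_set (a : R) (m : nat) (C : nat * nat) : set (R * R) :=
  [set` band a m C.1] `*` [set` band a m C.2].

Lemma mem_band_le (a x : R) m k : x \in band a m k ->
  (k%:R - m%:R) * a <= x <= (k%:R + 1 - m%:R) * a.
Proof.
rewrite /band in_itv /= -natr1 => /andP[-> /=].
by case: (k.+1 != m.*2) => //= /ltW.
Qed.

Lemma band_uniq (a x : R) m k l : 0 < a -> (k < m.*2)%N -> (l < m.*2)%N ->
  x \in band a m k -> x \in band a m l -> k = l.
Proof.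
move=> a0.
wlog kl : k l / (k <= l)%N.
  move=> H km lm xk xl; have [/H|/ltnW /H h] := leqP k l; first exact.
  by apply/esym; apply: h.
move=> km lm xk xl; apply/eqP; rewrite eqn_leq kl /= leqNgt; apply/negP => lt_kl.
move: xk; rewrite /band in_itv /= => /andP[_].
have -> : k.+1 != m.*2 by lia.
have /andP[xl' _] := mem_band_le _ _ _ _ xl.
rewrite /= => xk; have := le_lt_trans xl' xk; rewrite ltr_pM2r // ltrD2r ltr_nat; lia.
Qed.

Lemma band_exists (a x : R) m : 0 < a -> (0 < m)%N -> `|x| <= m%:R * a ->
  exists2 k, (k < m.*2)%N & x \in band a m k.
Proof.
move=> a0 m0; rewrite ler_norml => /andP[xl xu].
pose y := x / a + m%:R.
have xE : x = (y - m%:R) * a by rewrite /y addrK divfK // gt_eqF.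
have y0 : 0 <= y by rewrite /y -lerBlDr sub0r ler_pdivlMr // mulNr.
have yu : y <= (m.*2)%:R by rewrite /y -muln2 natrM mulr_natr mulr2n lerD2r ler_pdivrMr.
have [ym|ym] := ltP y (m.*2)%:R.
  have /andP[t1 t2] := truncn_itv y0.
  exists (Num.truncn y); first by rewrite -(ltr_nat R); apply: le_lt_trans ym.
  rewrite /band in_itv /= xE ler_pM2r // lerD2r t1 /=.
  apply: lteifS; rewrite ltr_pM2r // ltrD2r //.
(* Only y = 2m remains, and the last band is closed on the right. *)
exists (m.*2).-1; first by lia.
have e : (m.*2).-1.+1 = m.*2 by lia.
rewrite /band in_itv /= e eqxx /= xE !ler_pM2r // !lerD2r yu andbT.
by apply: le_trans ym; rewrite ler_nat; lia.
Qed.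

Lemma band_dist (a x y : R) m k l : 0 < a -> x \in band a m k -> y \in band a m l ->
  a * ((dist_nat k l)%:R - 1) <= `|x - y| <= a * ((dist_nat k l)%:R + 1).
Proof.
move=> a0 xk yl.
wlog kl : k l x y xk yl / (l <= k)%N.
  move=> H; have [|/ltnW] := leqP l k; first exact: H.
  by rewrite distrC /dist_nat addnC; apply: H.
have -> : (dist_nat k l)%:R = k%:R - l%:R :> R by rewrite -natrB // /dist_nat; congr _%:R; lia.
have /andP[x1 x2] := mem_band_le _ _ _ _ xk; have /andP[y1 y2] := mem_band_le _ _ _ _ yl.
have kl' : l%:R <= k%:R :> R by rewrite ler_nat.
have h : 0 <= (k%:R - l%:R) * a by rewrite mulr_ge0 ?subr_ge0 // ltW.
apply/andP; split.
  apply: le_trans (ler_norm _); lra.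
rewrite ler_norml; apply/andP; split; lra.
Qed.

Lemma band_norm (a x : R) m k : 0 < a -> x \in band a m k ->
  ((extent m k).-1)%:R * a <= `|x| <= (extent m k)%:R * a.
Proof.
move=> a0 /mem_band_le/andP[x1 x2]; rewrite /extent.
case: (leqP m k) => mk.
  have e1 : ((k.+1 - m).-1)%:R = k%:R - m%:R :> R by rewrite -natrB //; congr _%:R; lia.
  have e2 : (k.+1 - m)%:R = k%:R + 1 - m%:R :> R by rewrite natrB ?leqW // -natr1.
  rewrite e1 e2; have x0 : 0 <= x.
    by apply: le_trans x1; rewrite mulr_ge0 ?subr_ge0 ?ler_nat // ltW.
  by rewrite ger0_norm // x1.
have e1 : ((m - k).-1)%:R = m%:R - (k%:R + 1) :> R by rewrite natr1 -natrB //; congr _%:R; lia.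
have e2 : (m - k)%:R = m%:R - k%:R :> R by rewrite natrB // ltnW.
rewrite e1 e2; have x0 : x <= 0.
  apply: (le_trans x2); rewrite natr1 pmulr_lle0 // subr_le0 ler_nat; lia.
rewrite ler0_norm //; apply/andP; split; lra.
Qed.

Lemma diskE (g r : R) n (x : R * R) : n%:R `^ g = r ->
  diskA g n x = (x.1 ^+ 2 + x.2 ^+ 2 <= r ^+ 2) :> Prop.
Proof.
move=> er; have r0 : 0 <= r by rewrite -er powR_ge0.
rewrite /diskA /= er.
by rewrite -[X in _ <= X](ger0_norm r0) -sqrtr_sqr ler_sqrt // sqr_ge0.
Qed.

Section Grid.
Variables (g : R) (n m : nat).
Hypothesis n_gt0 : (0 < n)%N.
Hypothesis m_gt0 : (0 < m)%N.
Let a : R := n%:R `^ g / m%:R.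
Local Notation disk := (diskA g n).
Local Notation cell := (cell_set a m).

Let r0 : 0 < n%:R `^ g :> R. Proof. by rewrite powR_gt0 // ltr0n. Qed.
Let mR0 : 0 < m%:R :> R. Proof. by rewrite ltr0n. Qed.
Let a0 : 0 < a. Proof. by rewrite divr_gt0. Qed.
Let rE : n%:R `^ g = m%:R * a. Proof. by rewrite /a mulrC divfK // gt_eqF. Qed.

Lemma cell_exists x : disk x -> exists C : 'I_(m.*2) * 'I_(m.*2), cell (nat_of_ord C.1, nat_of_ord C.2) x.
Proof.
rewrite (diskE _ _ _ _ rE) => xd.
have ma0 : 0 <= m%:R * a by rewrite mulr_ge0 ?ltW.
have bnd (t s : R) : t ^+ 2 + s ^+ 2 <= (m%:R * a) ^+ 2 -> `|t| <= m%:R * a.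
  move=> h; rewrite -(ger0_norm ma0) -ler_sqr ?nnegrE // !real_normK ?num_real //.
  by apply: le_trans h; rewrite lerDl sqr_ge0.
have [k km xk] := band_exists a x.1 m a0 m_gt0 (bnd _ _ xd).
rewrite addrC in xd.
have [l lm xl] := band_exists a x.2 m a0 m_gt0 (bnd _ _ xd).
by exists (Ordinal km, Ordinal lm).
Qed.

Lemma cell_uniq x (C D : 'I_(m.*2) * 'I_(m.*2)) :
  cell (nat_of_ord C.1, nat_of_ord C.2) x -> cell (nat_of_ord D.1, nat_of_ord D.2) x -> C = D.
Proof.
case: C D => [c1 c2] [d1 d2] [/= x1 x2] [/= y1 y2]; congr pair; apply: val_inj => /=.
  exact: band_uniq x1 y1.
exact: band_uniq x2 y2.
Qed.

Lemma cell_in_disk C : inside m C -> cell C `<=` disk.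
Proof.
rewrite /inside => iC x [/= x1 x2]; rewrite (diskE _ _ _ _ rE).
have /andP[_ h1] := band_norm _ _ _ _ a0 x1; have /andP[_ h2] := band_norm _ _ _ _ a0 x2.
rewrite -[x.1 ^+ 2]real_normK ?num_real // -[x.2 ^+ 2]real_normK ?num_real //.
apply: (le_trans (_ : _ <= ((extent m C.1)%:R * a) ^+ 2 + ((extent m C.2)%:R * a) ^+ 2)).
  by apply: lerD; rewrite ler_sqr ?nnegrE // mulr_ge0 // ltW.
by rewrite !(exprMn 2 _ a) -mulrDl ler_pM2r ?exprn_gt0 // -!natrX -natrD ler_nat.
Qed.

Lemma disk_cell_extent C x : disk x -> cell C x ->
  ((extent m C.1).-1 ^ 2 + (extent m C.2).-1 ^ 2 <= m ^ 2)%N.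
Proof.
rewrite (diskE _ _ _ _ rE) => xd [/= x1 x2].
have /andP[h1 _] := band_norm _ _ _ _ a0 x1; have /andP[h2 _] := band_norm _ _ _ _ a0 x2.
rewrite -[x.1 ^+ 2]real_normK ?num_real // -[x.2 ^+ 2]real_normK ?num_real // in xd.
have : ((extent m C.1).-1%:R * a) ^+ 2 + ((extent m C.2).-1%:R * a) ^+ 2 <= (m%:R * a) ^+ 2.
  by apply: le_trans xd; apply: lerD; rewrite ler_sqr ?nnegrE // mulr_ge0 // ltW.
by rewrite !(exprMn 2 _ a) -mulrDl ler_pM2r ?exprn_gt0 // -!natrX -natrD ler_nat.
Qed.

Lemma measurable_disk : measurable (disk : set (R * R)).
Proof.
have -> : disk = setT `&` [set x : R * R | x.1 * x.1 + x.2 * x.2 <= (m%:R * a) ^+ 2].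
  by rewrite setTI; apply/seteqP; split => x; rewrite (diskE _ _ _ _ rE) !expr2.
apply: (@measurable_fun_le _ _ _ _ (fun x : R * R => x.1 * x.1 + x.2 * x.2) (cst _)) => //.
by apply: measurable_realfun.measurable_funD; apply: measurable_realfun.measurable_funM.
Qed.

Lemma measurable_cell C : measurable (cell C).
Proof. by apply: measurableX; exact: measurable_itv. Qed.

Lemma leb2_itv (i j : interval R) :
  leb2 ([set` i] `*` [set` j]) =
  (lebesgue_measure ([set` i] : set R) * lebesgue_measure ([set` j] : set R))%E.
Proof. by rewrite /leb2 product_measure1E //; exact: measurable_itv. Qed.

Lemma leb2_rect (x y : R) b1 b2 c1 c2 : x <= y ->
  leb2 ([set` Interval (BSide b1 x) (BSide b2 y)] `*` [set` Interval (BSide c1 x) (BSide c2 y)])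
    = ((y - x) ^+ 2)%:E.
Proof.
move=> xy; rewrite leb2_itv.
rewrite !lebesgue_measure_itv /= lte_fin; move: xy; rewrite le_eqVlt => /orP[/eqP ->|xy].
  by rewrite ltxx mule0 subrr expr0n.
by rewrite xy -EFinD -EFinM expr2.
Qed.

Lemma leb2_band_rect k l : leb2 (cell (k, l)) = (a ^+ 2)%:E.
Proof.
rewrite /cell_set leb2_itv.
have len j : (lebesgue_measure ([set` band a m j] : set R) = a%:E)%E.
  have lt : (j%:R - m%:R) * a < (j.+1%:R - m%:R) * a by rewrite ltr_pM2r // ltrD2r ltr_nat.
  rewrite lebesgue_measure_itv /= lte_fin lt -EFinD; congr EFin.
  by rewrite -natr1; ring.
by rewrite !len -EFinM expr2.
Qed.

(** Comparison with the centred squares whose sides are the radius and the diameter; constants are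
    immaterial, so the exact area is not computed. *)
Lemma leb2_disk_bounds : (((m%:R * a) ^+ 2)%:E <= leb2 (disk : set (R * R)) <= (4 * (m%:R * a) ^+ 2)%:E)%E.
Proof.
have ma0 : 0 < m%:R * a by rewrite mulr_gt0.
apply/andP; split.
  have -> : (m%:R * a) ^+ 2 = (m%:R * a / 2 - - (m%:R * a / 2)) ^+ 2 by field.
  rewrite -(leb2_rect (- (m%:R * a / 2)) (m%:R * a / 2) true false true false); last by lra.
  rewrite /leb2; apply: le_measure; rewrite ?inE.
  - by apply: measurableX; exact: measurable_itv.
  - exact: measurable_disk.
  - move=> x [/=]; rewrite !in_itv /= -!ler_norml => h1 h2; rewrite (diskE _ _ _ _ rE).
    rewrite -[x.1 ^+ 2]real_normK ?num_real // -[x.2 ^+ 2]real_normK ?num_real //.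
    have h0 : 0 <= m%:R * a / 2 by lra.
    apply: (le_trans (_ : _ <= (m%:R * a / 2) ^+ 2 + (m%:R * a / 2) ^+ 2)).
      by apply: lerD; rewrite ler_sqr ?nnegrE.
    by have := sqr_ge0 (m%:R * a); lra.
have -> : 4 * (m%:R * a) ^+ 2 = (m%:R * a - - (m%:R * a)) ^+ 2 by ring.
rewrite -(leb2_rect (- (m%:R * a)) (m%:R * a) true false true false); last by lra.
rewrite /leb2; apply: le_measure; rewrite ?inE.
- exact: measurable_disk.
- by apply: measurableX; exact: measurable_itv.
- move=> x; rewrite (diskE _ _ _ _ rE) => xd; split; rewrite /= in_itv /= -ler_norml;
    rewrite -[X in _ <= X](ger0_norm (ltW ma0)) -ler_sqr ?nnegrE // !real_normK ?num_real //;
    apply: le_trans xd.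
    by rewrite lerDl sqr_ge0.
  by rewrite lerDr sqr_ge0.
Qed.

Definition cell_prob (C : 'I_(m.*2) * 'I_(m.*2)) : R :=
  fine (leb2 (cell (nat_of_ord C.1, nat_of_ord C.2) `&` disk)) / fine (leb2 (disk : set (R * R))).

Let leb2_fin (A : set (R * R)) : measurable A -> A `<=` disk -> leb2 A \is a fin_num.
Proof.
move=> mA Ad; rewrite ge0_fin_numE; last exact: measure_ge0.
have /andP[_ h] := leb2_disk_bounds; apply: (@le_lt_trans _ _ (leb2 (disk : set (R * R)))).
  by rewrite /leb2; apply: le_measure; rewrite ?inE //; exact: measurable_disk.
by apply: le_lt_trans h _; rewrite ltry.
Qed.

Let disk_area_bounds : (m%:R * a) ^+ 2 <= fine (leb2 (disk : set (R * R))) <= 4 * (m%:R * a) ^+ 2.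
Proof.
have := leb2_disk_bounds; rewrite -(fineK (leb2_fin _ measurable_disk (@subset_refl _ _))).
by rewrite !lee_fin.
Qed.

Let sq0 : 0 < (m%:R * a) ^+ 2. Proof. by rewrite exprn_gt0 // mulr_gt0. Qed.

Let mcd C : measurable (cell C `&` disk).
Proof. by apply: measurableI; [exact: measurable_cell|exact: measurable_disk]. Qed.

Lemma cell_prob_ge0 C : 0 <= cell_prob C.
Proof. by rewrite /cell_prob divr_ge0 // fine_ge0 // /leb2 measure_ge0. Qed.

Lemma cell_prob_le C : cell_prob C <= (m%:R ^+ 2)^-1.
Proof.
have /andP[d1 _] := disk_area_bounds.
rewrite /cell_prob ler_pdivrMr; last exact: lt_le_trans d1.
apply: (le_trans (_ : _ <= a ^+ 2)).
  have fin := leb2_fin _ (mcd (nat_of_ord C.1, nat_of_ord C.2)) (@subIsetr _ _ _).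
  rewrite -lee_fin (fineK fin).
  rewrite -(leb2_band_rect (nat_of_ord C.1) (nat_of_ord C.2)) /leb2.
  by apply: le_measure; rewrite ?inE; [exact: mcd|exact: measurable_cell|move=> x []].
rewrite ler_pdivlMl ?exprn_gt0 //; by rewrite -(exprMn 2 _ a).
Qed.

Lemma cell_prob_ge (C : 'I_(m.*2) * 'I_(m.*2)) : inside m (nat_of_ord C.1, nat_of_ord C.2) ->
  (4 * m%:R ^+ 2)^-1 <= cell_prob C.
Proof.
move=> iC; have /andP[d1 d2] := disk_area_bounds.
rewrite /cell_prob setIidl; last exact: cell_in_disk.
rewrite leb2_band_rect /= ler_pdivlMr; last exact: lt_le_trans d1.
rewrite ler_pdivrMl ?mulr_gt0 ?exprn_gt0 //; apply: (le_trans d2).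
by rewrite (exprMn 2 _ a) mulrA.
Qed.

Lemma cell_prob_sum : \sum_C cell_prob C = 1.
Proof.
have /andP[d1 _] := disk_area_bounds.
have area_neq0 : fine (leb2 (disk : set (R * R))) != 0 by rewrite gt_eqF // (lt_le_trans _ d1).
rewrite -mulr_suml; apply: (mulIf area_neq0); rewrite divfK // mul1r.
pose F (C : 'I_(m.*2) * 'I_(m.*2)) := cell (nat_of_ord C.1, nat_of_ord C.2) `&` disk.
apply: EFin_inj; rewrite (fineK (leb2_fin _ measurable_disk (@subset_refl _ _))).
have {2}-> : disk = \bigcup_(C in [set C | predT C]) F C.
  apply/seteqP; split => [x xd|x [C _ []]] //.
  by have [C xC] := cell_exists x xd; exists C.
rewrite /leb2 measure_bigcup_fin.
- rewrite -sumEFin; apply: eq_bigr => C _.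
  by rewrite fineK //; apply: leb2_fin; [exact: mcd|exact: subIsetr].
- by move=> C; exact: mcd.
- by move=> C D x _ _ [h1 _] [h2 _]; exact: cell_uniq h1 h2.
Qed.

End Grid.
End Geometry.

Arguments band {R} a m k.
Arguments cell_set {R} a m C.
Arguments cell_prob {R} g n m C.

(** * Random layouts *)

Section Events.
Variable R : realType.

(** The event is a finite union over discrete configurations, disjoint because the sets A are; the
    law in [random_model] gives the probability of each one without fixed point. *)
Lemma layout_event (g : R) n (dO : measure_display) (Omega : measurableType dO)
  (Pr : probability Omega R) (sv : 'I_n -> Omega -> R * R) (dv : 'I_n -> Omega -> 'I_n)
  (T : finType) (A : T -> set (R * R)) (G : pred ({ffun 'I_n -> T} * {ffun 'I_n -> 'I_n})) :
  random_model g Pr sv dv -> (forall t, measurable (A t)) ->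
  (forall s t x, A s x -> A t x -> s = t) ->
  exists E : set Omega, [/\ measurable E,
    E `<=` [set w | exists x : {ffun 'I_n -> T} * {ffun 'I_n -> 'I_n},
                               [/\ forall i, x.2 i != i, G x &
                                  forall i, A (x.1 i) (sv i w) /\ dv i w = x.2 i]] &
    Pr E = (\sum_(x : {ffun 'I_n -> T} * {ffun 'I_n -> 'I_n} | [forall i, x.2 i != i] && G x)
      \prod_(i < n) (fine (leb2 (A (x.1 i) `&` diskA g n)) / fine (leb2 (diskA g n : set (R * R)))
                     / (n.-1)%:R))%:E].
Proof.
move=> [msv mdv law] mA disj.
pose F (x : {ffun 'I_n -> T} * {ffun 'I_n -> 'I_n}) : set Omega :=
  [set w | forall i, A (x.1 i) (sv i w) /\ dv i w = x.2 i].
have mF x : measurable (F x).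
  have -> : F x = \bigcap_(i in [set: 'I_n]) (sv i @^-1` A (x.1 i) `&` [set w | dv i w = x.2 i]).
    by apply/seteqP; split => w /= h i; [move=> _; exact: h|exact: (h i I)].
  apply: fin_bigcap_measurable => [|i _]; first exact: finite_finset.
  apply: measurableI; last exact: mdv.
  by rewrite -[X in measurable X]setTI; exact: msv.
exists (\bigcup_(x in [set x : {ffun 'I_n -> T} * {ffun 'I_n -> 'I_n} |
                     [forall i, x.2 i != i] && G x]) F x); split.
- by apply: fin_bigcup_measurable => [|x _]; [exact: finite_finset|exact: mF].
- by move=> w [x /= /andP[/forallP h Gx] Fx]; exists x.
- rewrite measure_bigcup_fin //.
    rewrite -sumEFin; apply: eq_bigr => x /andP[/forallP h _].
    exact: (law (fun i => A (x.1 i)) (fun i => x.2 i) (fun i => mA _) h).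
  move=> x y w _ _ hx hy; case: x y hx hy => [c d] [c' d'] hx hy; congr pair; apply/ffunP => i.
    by have [+ _] := hx i; have [+ _] := hy i => /= h1 h2; exact: disj h2 h1.
  by have [_ /= <-] := hx i; have [_ /= <-] := hy i.
Qed.

Definition good_layout (g : R) (n m B B' : nat) (pos : 'I_n -> R * R) (d : 'I_n -> 'I_n) : Prop :=
  exists cx cy : 'I_n -> nat,
  [/\ forall i, cell_set (n%:R `^ g / m%:R) m (cx i, cy i) (pos i),
      forall i, diskA g n (pos i), forall i, d i != i,
      forall C, inside m C -> exists i, (cx i, cy i) = C &
      forall k, [/\ (#|[set i | home m (cx i) == k]%SET| <= B)%N,
                    (#|[set i | home m (cy i) == k]%SET| <= B)%N,
                    (#|[set i | home m (cx (d i)) == k]%SET| <= B')%N &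
                    (#|[set i | home m (cy (d i)) == k]%SET| <= B')%N]].

Lemma home_lt m u : (0 < m)%N -> (u < m.*2)%N -> (home m u < m.*2)%N.
Proof. by rewrite /home => m0; case: (leqP m u) => h; lia. Qed.

(** [home] moves an index by at most 2, so preimages lie between k-2 and k+2. *)
Lemma card_home_preim N m k : (0 < m)%N -> (#|[set u : 'I_N | home m u == k]%SET| <= 5)%N.
Proof.
move=> m0; pose h (u : 'I_N) : 'I_5 := inord (u.+2 - k).
have hE u : u \in [set u : 'I_N | home m u == k]%SET -> (k <= u.+2)%N /\ nat_of_ord (h u) = (u.+2 - k)%N.
  rewrite inE => /eqP e; have := @home_dist m u m0; rewrite e /dist_nat => hd.
  by split; [lia|rewrite /h inordK //; lia].
rewrite -(card_in_imset (f := h)); first by apply: (leq_trans (max_card _)); rewrite card_ord.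
move=> u u' /hE[k1 e1] /hE[k2 e2] e; apply: val_inj => /=.
by have := congr1 (@nat_of_ord 5) e; rewrite e1 e2; lia.
Qed.

Lemma inside_lt m C : inside m C -> (C.1 < m.*2)%N /\ (C.2 < m.*2)%N.
Proof.
rewrite /inside => h.
have e1 : (extent m C.1 <= m)%N by rewrite -leq_sqr; lia.
have e2 : (extent m C.2 <= m)%N by rewrite -leq_sqr; lia.
move: e1 e2; have := extent_gt0 m C.1; have := extent_gt0 m C.2.
by rewrite /extent; case: (leqP m C.1) => ?; case: (leqP m C.2) => ?; lia.
Qed.

(** At most 5 strips of 2m cells share a home strip, and each cell has probability at most 1/m^2. *)
Lemma strip_prob (g : R) n m (b : bool) (k : 'I_(m.*2)) : (0 < n)%N -> (0 < m)%N ->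
  \sum_(C : 'I_(m.*2) * 'I_(m.*2) | home m (if b then C.1 else C.2) == k) cell_prob g n m C
    <= 10 / m%:R.
Proof.
move=> n0 m0; have mR : 0 < m%:R :> R by rewrite ltr0n.
apply: (le_trans (_ : _ <= \sum_(C : 'I_(m.*2) * 'I_(m.*2) |
    home m (if b then C.1 else C.2) == k) (m%:R ^+ 2)^-1)).
  by apply: ler_sum => C _; exact: cell_prob_le.
rewrite sumr_const.
have cle : (#|fun C : 'I_(m.*2) * 'I_(m.*2) => home m (if b then C.1 else C.2) == k|
    <= 5 * m.*2)%N.
  have := card_home_preim m.*2 m k m0; rewrite cardsE => h5.
  case: b.
    rewrite (eq_card (B := [predX [pred u : 'I_(m.*2) | home m u == k] & predT])); last first.
      by move=> [u v]; rewrite !inE andbT.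
    by rewrite cardX card_ord leq_mul2r h5 orbT.
  rewrite (eq_card (B := [predX predT & [pred u : 'I_(m.*2) | home m u == k]])); last first.
    by move=> [u v]; rewrite !inE.
  by rewrite cardX card_ord mulnC leq_mul2r h5 orbT.
rewrite -[X in X <= _]mulr_natr; apply: (le_trans (_ : _ <= (m%:R ^+ 2)^-1 * (10 * m%:R))).
  rewrite ler_pM2l ?invr_gt0 ?exprn_gt0 // -natrM ler_nat; apply: (leq_trans cle); lia.
by rewrite le_eqVlt; apply/orP; left; apply/eqP; field; rewrite gt_eqF.
Qed.

Lemma layout_likely (g : R) (n m B B' : nat) (dO : measure_display) (Omega : measurableType dO)
  (Pr : probability Omega R) (sv : 'I_n -> Omega -> R * R) (dv : 'I_n -> Omega -> 'I_n) :
  random_model g Pr sv dv -> (1 < n)%N -> (0 < m)%N ->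
  exists E : set Omega, [/\ measurable E,
    E `<=` [set w | good_layout g n m B B' (fun i => sv i w) (fun i => dv i w)] &
    ((1 - ((m.*2 * m.*2)%:R * expR (- (n%:R * (4 * m%:R ^+ 2)^-1))
       + (2 * m.*2)%:R * expR (n%:R * ((expR 1 - 1) * (10 / m%:R)) - B%:R)
       + (2 * m.*2)%:R * expR (2 * (expR 1 - 1) * B%:R - B'%:R)))%:E <= Pr E)%E].
Proof.
move=> model n1 m0; have n0 : (0 < n)%N by exact: ltnW.
pose N := m.*2.
pose cl (C : 'I_N * 'I_N) := (nat_of_ord C.1, nat_of_ord C.2).
(* The law keeps nodes in the disk only almost surely; intersecting records their membership and
   leaves the probabilities unchanged. *)
pose A (C : 'I_N * 'I_N) : set (R * R) := cell_set (n%:R `^ g / m%:R) m (cl C) `&` diskA g n.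
pose S (j : bool * 'I_N) (C : 'I_N * 'I_N) : bool := home m (if j.1 then C.1 else C.2) == j.2.
pose V (C : 'I_N * 'I_N) : bool := inside m (cl C).
pose G (x : {ffun 'I_n -> 'I_N * 'I_N} * {ffun 'I_n -> 'I_n}) :=
  placement_good n _ _ V S B B' x.1 x.2.
have [||E [mE EG PE]] := @layout_event g n dO Omega Pr sv dv _ A G model.
- by move=> C; apply: measurableI; [exact: measurable_cell|exact: (@measurable_disk R g n m)].
- by move=> C D x [xC _] [xD _]; exact: (@cell_uniq R g n m n0 m0 x C D xC xD).
exists E; split => //.
- apply: (subset_trans EG) => w [[c d] /= [dne Gx cd]].
  move: Gx; rewrite /G /placement_good /= => /and3P[/forallP cV /forallP cB /forallP cB'].
  exists (fun i => nat_of_ord (c i).1), (fun i => nat_of_ord (c i).2).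
  have dd i : dv i w = d i by case: (cd i).
  split.
  + by move=> i; have [[]] := cd i.
  + by move=> i; have [[]] := cd i.
  + by move=> i; rewrite dd.
  + move=> [u v] uv; have [/= uN vN] := inside_lt _ _ uv.
    have := cV (Ordinal uN, Ordinal vN); rewrite /V /cl /= uv /= => /existsP[i /eqP ci].
    by exists i; rewrite ci.
  + move=> k.
    have hlt (x : 'I_N) : (home m x < N)%N by apply: home_lt.
    (* [home] keeps indices below 2m, so strips beyond the grid are empty. *)
    have [kN|kN] := ltnP k N; last first.
      have no (f : 'I_n -> 'I_N) : #|[set i | home m (f i) == k]%SET| = 0%N.
        apply: eq_card0 => i; rewrite inE; apply/negP => /eqP e.
        by have := hlt (f i); rewrite e ltnNge kN.
      by rewrite (no (fun i => (c i).1)) (no (fun i => (c i).2))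
        (no (fun i => (c (dv i w)).1)) (no (fun i => (c (dv i w)).2)).
    have h1 := cB (true, Ordinal kN); have h2 := cB (false, Ordinal kN).
    have h3 := cB' (true, Ordinal kN); have h4 := cB' (false, Ordinal kN).
    split; [exact: h1|exact: h2| |].
      rewrite (_ : [set _ | _]%SET = [set i | S (true, Ordinal kN) (c (d i))]%SET) //.
      by apply/setP => i; rewrite !inE dd.
    rewrite (_ : [set _ | _]%SET = [set i | S (false, Ordinal kN) (c (d i))]%SET) //.
    by apply/setP => i; rewrite !inE dd.
- rewrite PE lee_fin.
  have := @placement_likely R n ('I_N * 'I_N)%type (bool * 'I_N)%type
    (cell_prob g n m) V S (10 / m%:R) ((4 * m%:R ^+ 2)^-1) B B' n1.
  rewrite !card_prod !card_ord card_bool => /(_ _ _ _ _)/le_trans; apply.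
  + by move=> C; exact: cell_prob_ge0.
  + exact: cell_prob_sum.
  + by move=> C; exact: cell_prob_ge.
  + by move=> [b k]; exact: strip_prob.
  + rewrite le_eqVlt; apply/orP; left; apply/eqP; apply: eq_bigr => x _; apply: eq_bigr => i _.
    by rewrite /A -setIA setIid.
Qed.

End Events.

(** * From random layouts to successful systems of bounded period *)

Section Network.
Variable R : realType.
Let kappa : R := expR 1 - 1.

Lemma kappa_ge0 : 0 <= expR 1 - 1 :> R.
Proof. by rewrite subr_ge0 expR_ge1. Qed.

(** From ln(1/n) <= 1/n - 1 <= -1/2. *)
Lemma ln_ge_half n : (1 < n)%N -> 1 / 2 <= ln n%:R :> R.
Proof.
move=> n1; have n2 : 2 <= n%:R :> R by rewrite ler_nat.
have n0 : 0 < n%:R :> R by lra.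
have i2 : n%:R^-1 <= 2^-1 :> R by rewrite lef_pV2 ?posrE.
have i0 : 0 < n%:R^-1 :> R by rewrite invr_gt0.
have := @le_ln1Dx R (n%:R^-1 - 1).
rewrite [1 + _]addrC subrK lnV ?posrE // => /(_ _); lra.
Qed.

(** The parentheses bound B and B' in units of n/m. *)
Definition load_const : R := 3 * (10 * kappa + 2) + 2 * (2 * kappa * (10 * kappa + 2) + 2).

(** All three exponents are at most -3 ln n and all three prefactors at most n, so each term is at
    most n^-2 <= 1/n. The constant 12 is 3 times the 4 of the cell probability. *)
Lemma load_bounds n m : (1 < n)%N -> (0 < m)%N -> 12 * m%:R ^+ 2 * ln n%:R <= n%:R :> R ->
  exists B B' : nat, (3 * B + 2 * B')%:R <= load_const * (n%:R / m%:R) /\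
    (m.*2 * m.*2)%:R * expR (- (n%:R * (4 * m%:R ^+ 2)^-1))
       + (2 * m.*2)%:R * expR (n%:R * (kappa * (10 / m%:R)) - B%:R)
       + (2 * m.*2)%:R * expR (2 * kappa * B%:R - B'%:R) <= 3 / n%:R.
Proof.
move=> n1 m0 mn; have k0 := kappa_ge0; rewrite -/kappa in k0.
have n0 : 0 < n%:R :> R by rewrite ltr0n ltnW.
have n1R : 1 <= n%:R :> R by rewrite ler1n ltnW.
have m1 : 1 <= m%:R :> R by rewrite ler1n.
have m0R : 0 < m%:R :> R by lra.
have l2 := ln_ge_half n n1; set L := ln n%:R in mn l2.
have mm : m%:R <= m%:R ^+ 2 :> R by rewrite expr2 ler_peMr // ltW.
have mm0 : 0 < m%:R ^+ 2 :> R by rewrite exprn_gt0.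
have h6 : 6 * m%:R ^+ 2 <= n%:R :> R.
  have : 12 * m%:R ^+ 2 * (1 / 2) <= 12 * m%:R ^+ 2 * L by rewrite ler_pM2l // mulr_gt0.
  lra.
pose x : R := n%:R / m%:R.
have x1 : 1 <= x by rewrite ler_pdivlMr // mul1r; lra.
have xL : 3 * L <= x.
  rewrite ler_pdivlMr //; apply: le_trans mn.
  have : m%:R * L <= m%:R ^+ 2 * L by rewrite ler_pM2r; lra.
  have : 0 <= m%:R ^+ 2 * L by rewrite mulr_ge0; lra.
  lra.
have tail c e : (c%:R <= n%:R :> R) -> e <= - (3 * L) -> c%:R * expR e <= 1 / n%:R.
  move=> cn eL; apply: (le_trans (_ : _ <= n%:R * expR (- (3 * L)))).
    by apply: ler_pM; rewrite ?expR_ge0 // ler_expR.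
  rewrite expRN expRM_natl lnK ?posrE // ler_pdivlMr //.
  rewrite mulrAC ler_pdivrMr ?exprn_gt0 // mul1r -[X in X <= _]expr2.
  by apply: ler_weXn2l.
(* B and B' exceed the positive part of their exponents by at least x = n/m >= 3 ln n; rounding up
   costs at most another x. *)
pose B := (Num.truncn ((10 * kappa + 1) * x)).+1.
pose B' := (Num.truncn (2 * kappa * B%:R + x)).+1.
have yB : 0 <= (10 * kappa + 1) * x by rewrite mulr_ge0; lra.
have /andP[B1 B2] : (Num.truncn ((10 * kappa + 1) * x))%:R <= (10 * kappa + 1) * x < B%:R.
  exact: truncn_itv.
have kB : 0 <= kappa * B%:R by rewrite mulr_ge0.
have yB' : 0 <= 2 * kappa * B%:R + x by lra.
have /andP[B'1 B'2] : (Num.truncn (2 * kappa * B%:R + x))%:R <= 2 * kappa * B%:R + x < B'%:R.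
  exact: truncn_itv.
exists B, B'; split.
  have b1 : B%:R <= (10 * kappa + 2) * x.
    by rewrite [B%:R](esym (natr1 _)); lra.
  have kb : kappa * B%:R <= kappa * ((10 * kappa + 2) * x) by rewrite ler_wpM2l.
  have b2 : B'%:R <= (2 * kappa * (10 * kappa + 2) + 2) * x.
    by rewrite [B'%:R](esym (natr1 _)); lra.
  rewrite natrD !natrM -/x /load_const; lra.
have e1 : n%:R * (kappa * (10 / m%:R)) = 10 * kappa * x by rewrite /x; field; rewrite gt_eqF.
have c4 : (m.*2 * m.*2)%:R = 4 * m%:R ^+ 2 :> R by rewrite -!muln2 !natrM; ring.
have c2 : (2 * m.*2)%:R = 4 * m%:R :> R by rewrite -!muln2 !natrM; ring.
have -> : 3 / n%:R = 1 / n%:R + 1 / n%:R + 1 / n%:R :> R by field; rewrite gt_eqF.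
apply: lerD; [apply: lerD|]; apply: tail.
- by rewrite c4; lra.
- rewrite lerN2 ler_pdivlMr ?mulr_gt0 //; lra.
- by rewrite c2; lra.
- by rewrite e1; lra.
- by rewrite c2; lra.
- by lra.
Qed.

Definition performs (alpha beta No P C : R) n m (pos : 'I_n -> R * R) (d : 'I_n -> 'I_n)
    (S : system n) : Prop :=
  [/\ is_system d S, successful alpha beta No P pos S & (period S)%:R <= C * (n%:R / m%:R)].

Lemma network_likely (alpha beta : R) : 2 < alpha -> 0 < beta ->
  exists2 C : R, 0 < C & forall (g No P : R) (n m : nat) (dO : measure_display)
    (Omega : measurableType dO) (Pr : probability Omega R)
    (sv : 'I_n -> Omega -> R * R) (dv : 'I_n -> Omega -> 'I_n),
  random_model g Pr sv dv -> (1 < n)%N -> (1 < m)%N ->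
  12 * m%:R ^+ 2 * ln n%:R <= n%:R :> R -> 1 / 3 <= n%:R `^ g / m%:R -> 0 < No ->
  2 * beta * No * (1 + 6 * (n%:R `^ g / m%:R)) `^ alpha <= P ->
  exists E : set Omega, [/\ measurable E,
    E `<=` [set w | exists S, performs alpha beta No P C n m (fun i => sv i w) (fun i => dv i w) S] &
    ((1 - 3 / n%:R)%:E <= Pr E)%E].
Proof.
move=> al2 b0; have [K K0 sinr] := successful_of_separation R alpha beta al2 b0.
have k0 := kappa_ge0; rewrite -/kappa in k0.
have kk : 0 <= kappa * kappa by rewrite mulr_ge0.
(* K * K counts the residue classes of cells, and 2 the source and relay roles. *)
exists (2 * (K * K)%:R * load_const).
  by rewrite mulr_gt0 // ?mulr_gt0 // ?ltr0n ?muln_gt0 ?K0 // /load_const; lra.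
move=> g No P n m dO Omega Pr sv dv model n1 m1 mn a3 No0 PP.
have m0 : (0 < m)%N by exact: ltnW.
have n0 : (0 < n)%N by exact: ltnW.
have [B [B' [BB BE]]] := load_bounds n m n1 m0 mn.
have [E [mE EG PE]] := layout_likely R g n m B B' dO Omega Pr sv dv model n1 m0.
exists E; split => //; last first.
  by apply: le_trans PE; rewrite lee_fin lerD2l lerN2.
apply: (subset_trans EG) => w [cx [cy [cP dP dne rel cnt]]] /=.
have a0 : 0 < n%:R `^ g / m%:R by lra.
have cnt1 k : (#|[set i | home m (cx i) == k]%SET| <= B)%N by case: (cnt k).
have cnt2 k : (#|[set i | home m (cy i) == k]%SET| <= B)%N by case: (cnt k).
have cnt3 k : (#|[set i | home m (cx (dv i w)) == k]%SET| <= B')%N by case: (cnt k).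
have cnt4 k : (#|[set i | home m (cy (dv i w)) == k]%SET| <= B')%N by case: (cnt k).
have ext i : ((extent m (cx i)).-1 ^ 2 + (extent m (cy i)).-1 ^ 2 <= m ^ 2)%N.
  exact: (@disk_cell_extent R g n m n0 m0 (cx i, cy i) _ (dP i) (cP i)).
have [S [sysS perS nearS sepS]] :=
  @routing n m K B B' cx cy (fun i => dv i w) m1 K0 dne ext rel cnt1 cnt2 cnt3 cnt4.
exists S; split => //.
- apply: (sinr n (n%:R `^ g / m%:R) No P _ cx cy S) => //.
    by move=> i j; have [hi _] := cP i; have [hj _] := cP j; exact: band_dist hi hj.
  by move=> i j; have [_ hi] := cP i; have [_ hj] := cP j; exact: band_dist hi hj.
- apply: (le_trans (_ : _ <= (K * K * (2 * (3 * B + 2 * B')))%:R)); first by rewrite ler_nat.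
  rewrite natrM [X in _ * X]natrM mulrA [_ * 2]mulrC -[X in _ <= X]mulrA ler_wpM2l //.
Qed.

End Network.

(** * Asymptotics *)

Section Asymptotics.
Variable R : realType.

Lemma whp_of_eventually (dO : nat -> measure_display) (Omega : forall n, measurableType (dO n))
    (Pr : forall n, probability (Omega n) R) (ev : forall n, set (Omega n)) (N : nat) :
  (forall n, (N <= n)%N -> exists E, [/\ measurable E, E `<=` ev n &
     ((1 - 3 / n%:R)%:E <= Pr n E)%E]) -> whp Pr ev.
Proof.
move=> H.
have H' n : exists E : set (Omega n), [/\ measurable E, E `<=` ev n &
    (N <= n)%N -> ((1 - 3 / n%:R)%:E <= Pr n E)%E].
  have [/H[E [mE sE PE]]|Nn] := leqP N n; first by exists E.
  by exists set0; split => //; exact: sub0set.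
exists (fun n => projT1 (cid (H' n))); split.
- by move=> n; case: (cid _) => E [].
- by move=> n; case: (cid _) => E [].
(* [harmonic n] is 1/(n+1), and 3/n <= 6/(n+1) for n >= 1. *)
apply: (@squeeze_cvge _ _ _ _ (fun n => (1 - 6 * harmonic n)%:E) _ (cst 1%E)).
- near=> n; case: (cid _) => E [mE _ PE] /=; apply/andP; split; last exact: probability_le1.
  apply: le_trans (PE _); last by near: n; exact: nbhs_infty_ge.
  have n1 : (0 < n)%N by near: n; exact: nbhs_infty_gt.
  have nR : 0 < n%:R :> R by rewrite ltr0n.
  rewrite lee_fin lerD2l lerN2 ler_pdivrMr // mulrAC ler_pdivlMr ?ltr0n // -natr1.
  have : 1 <= n%:R :> R by rewrite ler1n.
  lra.
- apply: cvg_EFin; first by near=> n.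
  rewrite /= -[X in _ --> X]subr0 -[X in _ --> _ - X](mulr0 6).
  by apply: cvgB; [exact: cvg_cst|apply: cvgM; [exact: cvg_cst|exact: cvg_harmonic]].
- exact: cvg_cst.
Unshelve. all: by end_near. Qed.

Lemma powR_ge_eventually (e C : R) : 0 < e ->
  exists N, forall n, (N <= n)%N -> C <= n%:R `^ e.
Proof.
move=> e0; pose D := `|C| + 1; have D0 : 0 < D by rewrite ltr_wpDl.
exists (Num.truncn (D `^ e^-1)).+1 => n Nn.
apply: (le_trans (_ : _ <= D)).
  by apply: (le_trans (ler_norm C)); rewrite /D lerDl.
have -> : D = (D `^ e^-1) `^ e by rewrite -powRrM mulVf ?gt_eqF // powRr1 // ltW.
apply: ge0_ler_powR; rewrite ?nnegrE ?powR_ge0 ?ler0n //; first exact: ltW.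
apply: (le_trans (ltW (truncnS_gt _))); by rewrite ler_nat.
Qed.

(** This is ln y <= y - 1 at y = x^e. *)
Lemma ln_le_powR (e x : R) : 0 < e -> 0 < x -> ln x <= x `^ e / e.
Proof.
move=> e0 x0; rewrite ler_pdivlMr // mulrC -ln_powR.
have y0 : 0 < x `^ e by rewrite powR_gt0.
have := @le_ln1Dx R (x `^ e - 1).
rewrite [1 + _]addrC subrK => /(_ _) h; apply: (le_trans (h _)); lra.
Qed.

Definition grid_sparse (g : R) (n : nat) : nat := (Num.truncn (n%:R `^ g : R)).+2.
(** With y the square root, m <= y + 2 gives m^2 <= 2 y^2 + 8; the 48 makes the y^2 part of 12 m^2
    ln n equal to n/2, leaving n/2 for the rounding. *)
Definition grid_dense (n : nat) : nat := (Num.truncn (Num.sqrt (n%:R / (48 * ln n%:R)) : R)).+2.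

Lemma truncnSS_bounds (y : R) : 0 <= y -> y <= (Num.truncn y).+2%:R <= y + 2.
Proof.
move=> /truncn_itv/andP[h1 h2]; rewrite -natr1 -natr1 in h2 *; lra.
Qed.

(** The last two bounds keep the cell side between 1/3 and 1: large enough against interference,
    small enough for a power independent of n. *)
Lemma grid_sparse_cond (g : R) : 0 <= g -> g < 1 / 2 ->
  exists N, forall n, (N <= n)%N ->
    [/\ (1 < n)%N, 12 * (grid_sparse g n)%:R ^+ 2 * ln n%:R <= n%:R :> R,
        n%:R `^ g <= (grid_sparse g n)%:R & (grid_sparse g n)%:R <= 3 * n%:R `^ g].
Proof.
(* Then n = n^(2g) n^(2e), and 12 * 9 n^(2g) ln n is absorbed once n^e >= 108 / e. *)
move=> g0 g2; pose e := (1 - 2 * g) / 2; have e0 : 0 < e by rewrite /e; lra.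
have [N NP] := powR_ge_eventually e (108 / e) e0.
exists (maxn N 2) => n; rewrite geq_max => /andP[/NP ne n1].
have n0 : 0 < n%:R :> R by rewrite ltr0n ltnW.
have g1 : 1 <= n%:R `^ g.
  by rewrite -[X in X <= _](powRr0 n%:R); apply: ler_powR => //; rewrite ler1n ltnW.
have /andP[h1 h2] := truncnSS_bounds _ (powR_ge0 n%:R g).
have h3 : (grid_sparse g n)%:R <= 3 * n%:R `^ g by rewrite /grid_sparse; lra.
split => //.
have hm : (grid_sparse g n)%:R ^+ 2 <= 9 * (n%:R `^ g * n%:R `^ g) :> R.
  rewrite expr2; apply: (le_trans (ler_pM _ _ h3 h3)); rewrite ?ler0n //; lra.
have l0 : 0 <= ln n%:R :> R by rewrite ln_ge0 // ler1n ltnW.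
have hl := ln_le_powR e _ e0 n0.
apply: (le_trans (_ : _ <= 12 * (9 * (n%:R `^ g * n%:R `^ g)) * (n%:R `^ e / e))).
  apply: ler_pM; [by rewrite mulr_ge0 // sqr_ge0|exact: l0|by rewrite ler_pM2l|exact: hl].
have nE : n%:R = n%:R `^ g * n%:R `^ g * (n%:R `^ e * n%:R `^ e) :> R.
  have nz (b : bool) : b ==> (n%:R != 0 :> R) by rewrite gt_eqF // implybT.
  rewrite -!powRD //.
  by rewrite (_ : g + g + (e + e) = 1) ?powRr1 ?ltW // /e; field.
rewrite [X in _ <= X]nE.
have -> : 12 * (9 * (n%:R `^ g * n%:R `^ g)) * (n%:R `^ e / e) =
  n%:R `^ g * n%:R `^ g * (n%:R `^ e * (108 / e)) by ring.
by rewrite !ler_wpM2l ?mulr_ge0 ?powR_ge0.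
Qed.

Lemma grid_dense_cond :
  exists N, forall n, (N <= n)%N ->
    [/\ (1 < n)%N, 12 * (grid_dense n)%:R ^+ 2 * ln n%:R <= n%:R :> R,
        (forall g : R, 1 / 2 <= g -> (grid_dense n)%:R <= 3 * n%:R `^ g) &
        n%:R / (grid_dense n)%:R <= 7 * Num.sqrt (n%:R * ln n%:R) :> R].
Proof.
(* Rounding requires 192 ln n <= n, and ln n <= 2 n^(1/2). *)
have [N NP] := powR_ge_eventually (1 / 2) 384 ltac:(lra).
exists (maxn N 2) => n; rewrite geq_max => /andP[/NP ne n1].
have n0 : 0 < n%:R :> R by rewrite ltr0n ltnW.
have n1R : 1 <= n%:R :> R by rewrite ler1n ltnW.
have l2 := ln_ge_half R n n1; rewrite /grid_dense; set L := ln n%:R in l2 *.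
have L0 : 0 < L by lra.
set y := Num.sqrt _; have y0 : 0 <= y by exact: sqrtr_ge0.
have yy : 48 * L * y ^+ 2 = n%:R.
  rewrite sqr_sqrtr; last by rewrite divr_ge0 // ?ler0n //; lra.
  by field; rewrite gt_eqF.
have /andP[h1 h2] := truncnSS_bounds _ y0; set m := (_.+2)%:R in h1 h2 *.
have m0 : 0 < m by rewrite ltr0n.
have nn : n%:R = n%:R `^ (1 / 2) * n%:R `^ (1 / 2) :> R.
  rewrite -powRD; last by rewrite gt_eqF ?implybT.
  by rewrite (_ : 1 / 2 + 1 / 2 = 1) ?powRr1 ?ltW //; lra.
have hl := ln_le_powR (1 / 2) _ ltac:(lra) n0; rewrite -/L in hl.
split => //.
- have : 192 * L <= n%:R.
    rewrite nn; apply: (le_trans (_ : _ <= 384 * n%:R `^ (1 / 2))); first by lra.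
    by rewrite ler_wpM2r // powR_ge0.
  have hm : m ^+ 2 <= 2 * y ^+ 2 + 8.
    apply: (le_trans (_ : _ <= (y + 2) ^+ 2)).
      by rewrite ler_sqr ?nnegrE; lra.
    by rewrite -subr_ge0 (_ : _ - _ = (y - 2) ^+ 2) ?sqr_ge0 //; ring.
  have : m ^+ 2 * L <= (2 * y ^+ 2 + 8) * L by rewrite ler_wpM2r // ltW.
  lra.
- move=> g g2; have hy : y <= n%:R `^ (1 / 2).
    rewrite -ler_sqr ?nnegrE ?powR_ge0 // [X in _ <= X]expr2 -nn -yy.
    by rewrite ler_peMl ?sqr_ge0 //; lra.
  have hg : n%:R `^ (1 / 2) <= n%:R `^ g by exact: ler_powR.
  lra.
- rewrite ler_pdivrMr //; apply: (le_trans (_ : _ <= 7 * Num.sqrt (n%:R * L) * y)); last first.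
    by rewrite ler_wpM2l // mulr_ge0 ?sqrtr_ge0.
  (* The square of the left side is 48 n L, and 48 <= 7^2. *)
  have hs : 48 * L * y <= 7 * Num.sqrt (n%:R * L).
    rewrite -ler_sqr ?nnegrE; [|by rewrite !mulr_ge0 // ltW|by rewrite mulr_ge0 // sqrtr_ge0].
    rewrite [X in _ <= X]exprMn sqr_sqrtr; last by rewrite mulr_ge0 // ltW.
    have -> : (48 * L * y) ^+ 2 = 48 * (n%:R * L) by rewrite -yy; ring.
    by rewrite ler_wpM2r ?mulr_ge0 ?ltW //; lra.
  rewrite -{1}yy expr2 mulrA; exact: ler_wpM2r.
Qed.

End Asymptotics.

(** * Fallback systems, throughput and final assembly *)

(** Single-hop routes, source i alone in slot i+1; used for layouts where no performing system
    exists. *)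
Lemma direct_system n (d : 'I_n -> 'I_n) : (forall i, d i != i) -> exists S, is_system d S.
Proof.
move=> dne; exists (fun i => SRoute [:: i; d i] [:: (i : nat).+1]); split.
  by move=> i; split => //=; rewrite inE eq_sym dne.
move=> i1 i2 [|j1] [|j2] //= _ _ ne []; rewrite /hslot /= => -[] e.
by case: ne; rewrite (val_inj e).
Qed.

Lemma period_gt0 n (d : 'I_n -> 'I_n) (S : system n) : (0 < n)%N -> is_system d S -> (0 < period S)%N.
Proof.
move=> n0 [/(_ (Ordinal n0))[_ + _ _ +] _]; rewrite /nhops.
case e : (rslots (S (Ordinal n0))) => [|s l] //= _ /andP[s0 _].
apply: (leq_trans s0); rewrite /period (bigD1 (Ordinal n0)) //= leq_max; apply/orP; left.
by rewrite e big_cons leq_maxl.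
Qed.

Lemma throughput_ge (R : realType) n (d : 'I_n -> 'I_n) (S : system n) (W X : R) :
  (0 < n)%N -> is_system d S -> 0 < W -> (period S)%:R <= X -> W / X <= throughput W S.
Proof.
move=> n0 sysS W0 pX; have p0 : 0 < (period S)%:R :> R by rewrite ltr0n (period_gt0 _ _ _ n0 sysS).
rewrite /throughput ler_pM2l // lef_pV2 ?posrE //; exact: lt_le_trans pX.
Qed.

Theorem theorem1 (R : realType) (alpha beta : R) :
  2 < alpha -> 0 < beta ->
  (* constants c, cbar depending only on alpha, beta *)
  exists c cbar : R, 0 < c /\ 0 < cbar /\
  (* power for gamma < 1/2: a function of No only;
     power for gamma >= 1/2: a function of No, gamma and n *)
  exists (Plow : R -> R) (Phigh : R -> R -> nat -> R),
    (forall No, 0 < No -> 0 < Plow No) /\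
    (forall No gamma n, 0 < No -> 1 / 2 <= gamma -> 0 < Phigh No gamma n) /\
    (forall No gamma (n m : nat), 0 < No -> 1 / 2 <= gamma -> (n < m)%N ->
       Phigh No gamma n < Phigh No gamma m) /\
    (forall No gamma gamma' (n : nat), 0 < No -> 1 / 2 <= gamma -> gamma < gamma' ->
       Phigh No gamma n < Phigh No gamma' n) /\
  forall No gamma : R, 0 < No -> 0 <= gamma ->
  let Pw (n : nat) := if gamma < 1 / 2 then Plow No else Phigh No gamma n in
  (* for every n and every source-destination set, a system *)
  exists Sys : forall n : nat, ('I_n -> R * R) -> ('I_n -> 'I_n) -> system n,
    (forall n (pos : 'I_n -> R * R) (d : 'I_n -> 'I_n),
       (forall i, d i != i) -> is_system d (Sys n pos d)) /\
    (* probabilities over the random source-destination set *)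
    forall (dO : nat -> measure_display) (Omega : forall n, measurableType (dO n))
           (Pr : forall n, probability (Omega n) R)
           (sv : forall n, 'I_n -> Omega n -> R * R)
           (dv : forall n, 'I_n -> Omega n -> 'I_n),
      (forall n, random_model gamma (Pr n) (sv n) (dv n)) ->
      forall W : R, 0 < W ->
        whp Pr (fun n => [set w | let S := Sys n (fun i => sv n i w) (fun i => dv n i w) in
                   is_system (fun i => dv n i w) S /\
                   successful alpha beta No (Pw n) (fun i => sv n i w) S]) /\
        (if gamma < 1 / 2 then
           whp Pr (fun n => [set w |
              throughput W (Sys n (fun i => sv n i w) (fun i => dv n i w))
                >= W / (c * (n%:R `^ (1 - gamma)))])
         else
           whp Pr (fun n => [set w |
              throughput W (Sys n (fun i => sv n i w) (fun i => dv n i w))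
                >= W / (cbar * Num.sqrt (n%:R * ln n%:R))])).
Proof.
move=> al2 b0; have [C C0 net] := network_likely R alpha beta al2 b0.
exists C, (7 * C); split => //; split; first by rewrite mulr_gt0.
pose noise No := 2 * beta * No.
have noise_gt0 No : 0 < No -> 0 < noise No by move=> No0; rewrite !mulr_gt0.
(* Taking n+1 keeps the base at least 1, so the gain is monotone in g for every n. *)
pose gain (g : R) (n : nat) := (1 + 6 * n.+1%:R `^ g) `^ alpha.
(* The terms n + g only serve to make the power strictly increasing, including
   at n = 0. *)
pose Phigh No (g : R) (n : nat) := noise No * (gain g n + n%:R + g).
(* In the sparse case the cell side is at most 1, so 1 + 6 a <= 7. *)
exists (fun No => noise No * 7 `^ alpha), Phigh.
have gain_le (g g' : R) (n n' : nat) : n.+1%:R `^ g <= n'.+1%:R `^ g' -> gain g n <= gain g' n'.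
  move=> h; have p0 : 0 <= n.+1%:R `^ g by exact: powR_ge0.
  by apply: ge0_ler_powR; rewrite ?nnegrE; lra.
split; first by move=> No No0; rewrite mulr_gt0 ?noise_gt0 // powR_gt0.
split.
  move=> No g n No0 g2; rewrite mulr_gt0 ?noise_gt0 //.
  by rewrite ltr_wpDl ?addr_ge0 ?powR_ge0 //; lra.
split.
  move=> No g n n' No0 g2 nn'; rewrite /Phigh ltr_pM2l ?noise_gt0 // ltrD2r.
  apply: ler_ltD; last by rewrite ltr_nat.
  by apply/gain_le/ge0_ler_powR; rewrite ?nnegrE ?ler0n // ?ler_nat ?ltnS ?(ltnW nn') //; lra.
split.
  move=> No g g' n No0 g2 gg'; rewrite /Phigh ltr_pM2l ?noise_gt0 //.
  apply: ler_ltD => //; rewrite lerD2r.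
  by apply/gain_le/ler_powR; [rewrite ler1n|exact: ltW].
move=> No g No0 g0 Pw.
pose m n := if g < 1 / 2 then grid_sparse R g n else grid_dense R n.
(* The system must depend on positions and destinations only: a performing one if any exists,
   otherwise a direct one, and empty routes when d has a fixed point. *)
have choose n (pos : 'I_n -> R * R) (d : 'I_n -> 'I_n) : exists S : system n,
    ((forall i, d i != i) -> is_system d S) /\
    ((exists S', performs R alpha beta No (Pw n) C n (m n) pos d S') ->
     performs R alpha beta No (Pw n) C n (m n) pos d S).
  have [[S pS]|noS] := pselect (exists S', performs R alpha beta No (Pw n) C n (m n) pos d S').
    by exists S; split => // _; case: pS.
  have [dne|dne] := pselect (forall i, d i != i); last by exists (fun=> SRoute [::] [::]); split.
  by have [S sysS] := direct_system n d dne; exists S; split.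
exists (fun n pos d => projT1 (cid (choose n pos d))); split.
  by move=> n pos d dne; case: (cid _) => S [/= + _]; exact.
move=> dO Omega Pr sv dv model W W0.
have main : exists N, forall n, (N <= n)%N -> (1 < n)%N /\
    exists E, [/\ measurable E,
      E `<=` [set w | exists S, performs R alpha beta No (Pw n) C n (m n)
                        (fun i => sv n i w) (fun i => dv n i w) S] &
      ((1 - 3 / n%:R)%:E <= Pr n E)%E].
  have b2 : 0 <= noise No by rewrite ltW ?noise_gt0.
  have third (x y : R) : 0 < y -> y <= 3 * x -> 1 / 3 <= x / y.
    by move=> y0 yx; rewrite ler_pdivlMr //; lra.
  have [g2|g2] := ltP g (1 / 2).
    have [N NP] := grid_sparse_cond R g g0 g2; exists N => n /NP[n1 nm gm mg]; split => //.
    rewrite /Pw /m g2.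
    have m0 : 0 < (grid_sparse R g n)%:R :> R by rewrite ltr0n.
    apply: (net g No _ n _ _ _ _ _ _ (model n) n1) => //; first exact: third.
    rewrite ler_wpM2l //; apply: ge0_ler_powR; rewrite ?nnegrE; [lra| |lra|].
      by rewrite addr_ge0 // mulr_ge0 // divr_ge0 ?powR_ge0 // ltW.
    have : n%:R `^ g / (grid_sparse R g n)%:R <= 1 by rewrite ler_pdivrMr // mul1r.
    lra.
  have [N NP] := grid_dense_cond R; exists N => n /NP[n1 nm mg _]; split => //.
  rewrite /Pw /m ltNge g2 /=.
  have m0 : 0 < (grid_dense R n)%:R :> R by rewrite ltr0n.
  apply: (net g No _ n _ _ _ _ _ _ (model n) n1) => //; first by apply: third => //; exact: mg.
  rewrite ler_wpM2l // -addrA; apply: ler_wpDr; first by rewrite addr_ge0.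
  have q0 : 0 <= n%:R `^ g / (grid_dense R n)%:R by rewrite divr_ge0 ?powR_ge0 // ltW.
  apply: ge0_ler_powR; rewrite ?nnegrE; [lra|lra| |].
    by rewrite addr_ge0 // mulr_ge0 // powR_ge0.
  rewrite lerD2l ler_pM2l //; apply: (le_trans (_ : _ <= n%:R `^ g)).
    by rewrite ler_pdivrMr // ler_peMr ?powR_ge0 // ler1n.
  by apply: ge0_ler_powR; rewrite ?nnegrE ?ler0n // ler_nat.
have [N NP] := main.
(* Success and throughput concern the same chosen system, so both reduce to its performing with high
   probability. *)
have whp_perf (ev : forall n, set (Omega n)) (N' : nat) :
    (forall n w, (N' <= n)%N -> (1 < n)%N ->
      let S := projT1 (cid (choose n (fun i => sv n i w) (fun i => dv n i w))) in
      performs R alpha beta No (Pw n) C n (m n) (fun i => sv n i w) (fun i => dv n i w) S ->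
      ev n w) -> whp Pr ev.
  move=> evP; apply: (@whp_of_eventually R _ _ _ _ (maxn N N')) => n.
  rewrite geq_max => /andP[/NP[n1 [E [mE EP PE]]] N'n]; exists E; split => // w /EP perf.
  by apply: evP => //; case: (cid _) => S [/= _]; exact.
split.
  by apply: (whp_perf _ 0%N) => n w _ _ S [].
case: ifPn => [g2|]; last rewrite -leNgt => g2.
  have [N' N'P] := grid_sparse_cond R g g0 g2.
  apply: (whp_perf _ N') => n w /N'P[_ nm gm mg] n1 S [sysS _ perS].
  apply: (throughput_ge R n _ S _ _ (ltnW n1) sysS W0); apply: (le_trans perS).
  rewrite /m g2 ler_pM2l //.
  have n0 : 0 < n%:R :> R by rewrite ltr0n ltnW.
  rewrite powRB; last by apply/implyP => _; rewrite gt_eqF.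
  rewrite powRr1 ?ler0n // ler_pM2l // lef_pV2 // posrE ?ltr0n // powR_gt0 //.
have [N' N'P] := grid_dense_cond R.
apply: (whp_perf _ N') => n w /N'P[_ nm mg nle] n1 S [sysS _ perS].
apply: (throughput_ge R n _ S _ _ (ltnW n1) sysS W0); apply: (le_trans perS).
by rewrite /m ltNge g2 /= [7 * C]mulrC -mulrA ler_pM2l.
Qed.
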